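(* Let $0<\lambda<\lambda_U$ and let $n\ge 0$ be fixed. Then for every $\epsilon>0$ with $\epsilon<\lambda_U/\lambda$, $$\left|u_d^{N_f}(t_n;x)-u_d(t_n;x)\right|=\mathcal{O}\left(\left(\frac{\lambda_U}{\lambda}-\epsilon\right)^{-N_f}\right)\quad\text{as } N_f\rightarrow\infty,$$ where $$u_d(t_n;x)=\frac{1}{2\pi i}\int_{|z|=\lambda}\frac{U_d(z;x)}{z^{n+1}}\,dz,\qquad u_d^{N_f}(t_n;x)=\frac{1}{N_f}\sum_{k=1}^{N_f}\frac{U_d(z_k;x)}{z_k^{n}},\qquad z_k=\lambda e^{2\pi i k/N_f}.$$
   Context: Let $\Omega\subset\mathbb{R}^3$ be a bounded domain with (sufficiently regular) boundary $\Gamma$ and exterior $\Omega^{+}=\mathbb{R}^3\setminus\overline{\Omega}$; $x$ denotes a fixed point of $\Omega^+$. Helmholtz solution operator and scattering poles: for $k\in\mathbb{C}$ consider the exterior Helmholtz problem $\Delta v+k^2v=0$ in $\Omega^+$, $v=g$ on $\Gamma$, with $v$ outgoing, meaning that for $r=|x|>r_0$ (where the sphere of radius $r_0$ surrounds $\Omega$) $v$ can be expanded as $v(x)=\sum_{n=0}^\infty\sum_{m=-n}^n a_{n,m}h_n^{(1)}(kr)Y_n^m(x/|x|)$, with $h_n^{(1)}$ the spherical Hankel functions of the first kind and $Y_n^m$ the spherical harmonics. $\mathcal{B}(k)$ denotes the solution operator mapping the Dirichlet data $g$ to the solution $v$. It is a known fact that $\mathcal{B}$ is a meromorphic operator-valued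 function of $k$, whose poles $p_j$, $j=1,2,\dots$, satisfy $\mathrm{Im}\{p_j\}<0$ (scattering poles). Time-stepping rule: $c>0$ is the wave speed, $\Delta t>0$ is the time step, $t_n=n\Delta t$, and $\gamma(z)=\sum_{n\ge 0}\gamma_n z^n$, where $(\gamma_n)$ are the coefficients of a multistep rule $\frac{1}{c\Delta t}\sum_{j=0}^n\gamma_{n-j}Y_d(t_j)=\mathcal{L}Y_d(t_n)$, all but finitely many $\gamma_n$ being zero; thus $\gamma$ is a (nonconstant) polynomial. Put $k_z=i\gamma(z)/(c\Delta t)$ and $\mathcal{B}_U(z):=\mathcal{B}(k_z)$. Boundary data: $g(t;x)$, $t\ge0$, $x\in\Gamma$, is the given Dirichlet data of the wave equation, and $G(z;x)=\sum_{n=0}^\infty g(t_n;x)z^n$. $\lambda_G$ is the radius of analyticity of $G$, i.e. $z\mapsto G(z;\cdot)$ is analytic in $|z|<\lambda_G$ ($\lambda_G=\infty$ is allowed). $\lambda_{\mathcal{B}}:=\min_j|z_j|$, where the $z_j$ are the complex numbers for which $i\gamma(z_j)/(c\Delta t)$ is one of the scattering poles, and $\lambda_U:=\min\{\lambda_{\mathcal{B}},\lambda_G\}$, a finite number. $U_d(z;x):=[\mathcal{B}_U(z)G(z;\cdot)](x)$, i.e. $U_d(z;\cdot)$ is the outgoing (with wavenumber $k_z$) solution of $\left(\frac{\gamma(z)}{c\Delta t}\right)^2U_d-\Delta U_d=0$ in $\Omega^+$ with $U_d=G(z;\cdot)$ on $\Gamma$. The function $z\mapsto U_d(z;x)$ is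 analytic for $|z|<\lambda_U$. Contours are positively oriented; by Cauchy's theorem $u_d(t_n;x)$ does not depend on the choice of $\lambda\in(0,\lambda_U)$. The implied constant in $\mathcal{O}$ may depend on $n$, $x$, $\lambda$ and $\epsilon$, but not on $N_f$. *)

(* Defs.v *)
(* Stdlib reals with Coquelicot. *)
From Stdlib Require Import Reals ZArith.
From Coquelicot Require Import Coquelicot.
Open Scope R_scope.

(** * Complex numbers *)

Definition Cexp (z : C) : C := (exp (Re z) * cos (Im z), exp (Re z) * sin (Im z)).

Definition Csum (f : nat -> C) (m n : nat) : C := @sum_n_m C_AbelianMonoid f m n.

Definition Cconverges (a : nat -> C) : Prop :=
  @ex_series C_AbsRing C_NormedModule a.

(* Total sum of a complex series; only meaningful under [Cconverges]. *)
Definition CSeries (a : nat -> C) : C :=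
  (Series (fun n => Re (a n)), Series (fun n => Im (a n))).

(* Positively oriented circle |z| = r, parametrized by z = r e^{it}. *)
Definition circle_integral (f : C -> C) (r : R) : C :=
  @RInt C_R_CompleteNormedModule
    (fun t => let z := (RtoC r * Cexp (Ci * RtoC t))%C in (f z * (Ci * z))%C)
    0 (2 * PI).

(** * Geometry of R^3 *)

Definition R3 : Type := (R * R * R)%type.

Definition norm3 (x : R3) : R :=
  sqrt (fst (fst x) ^ 2 + snd (fst x) ^ 2 + snd x ^ 2).

Definition bounded_set (A : R3 -> Prop) : Prop :=
  exists r, forall x, A x -> norm3 x <= r.

Definition connected_set (A : R3 -> Prop) : Prop :=
  forall V W : R3 -> Prop, open V -> open W ->
    (forall x, A x -> V x \/ W x) ->
    (exists x, A x /\ V x) -> (exists x, A x /\ W x) ->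
    exists x, A x /\ V x /\ W x.

Definition bounded_domain (Omega : R3 -> Prop) : Prop :=
  (exists x, Omega x) /\ open Omega /\ connected_set Omega /\ bounded_set Omega.

Definition closure3 (A : R3 -> Prop) (x : R3) : Prop :=
  ~ locally x (fun y => ~ A y).

Definition boundary (Omega : R3 -> Prop) (x : R3) : Prop :=
  closure3 Omega x /\ ~ locally x Omega.

Definition exterior (Omega : R3 -> Prop) (x : R3) : Prop :=
  ~ closure3 Omega x.

(* Heine-Borel form of compactness. *)
Definition compact_subset (K A : R3 -> Prop) : Prop :=
  closed K /\ bounded_set K /\ (forall x, K x -> A x).

(** * The Laplacian *)

Definition move (i : nat) (x : R3) (t : R) : R3 :=
  match i, x with
  | O, (x1, x2, x3) => (x1 + t, x2, x3)
  | S O, (x1, x2, x3) => (x1, x2 + t, x3)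
  | _, (x1, x2, x3) => (x1, x2, x3 + t)
  end.

Definition partial (i : nat) (v : R3 -> C) (x : R3) : C :=
  (Derive (fun t => Re (v (move i x t))) 0, Derive (fun t => Im (v (move i x t))) 0).

Definition C1_on (U : R3 -> Prop) (v : R3 -> C) : Prop :=
  continuous_on U v /\
  forall i, (i < 3)%nat ->
    (forall x, U x -> ex_derive (fun t => Re (v (move i x t))) 0 /\
                      ex_derive (fun t => Im (v (move i x t))) 0) /\
    continuous_on U (partial i v).

Definition C2_on (U : R3 -> Prop) (v : R3 -> C) : Prop :=
  C1_on U v /\ forall i, (i < 3)%nat -> C1_on U (partial i v).

Definition laplacian (v : R3 -> C) (x : R3) : C :=
  Csum (fun i => partial i (partial i v) x) 0 2.

(** * Outgoing waves *)

(* For z <> 0,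
   h_n^(1)(z) = (-i)^{n+1} (e^{iz} / z) sum_{m=0}^n (n+m)! / (m! (n-m)!) (i / (2z))^m,
   a terminating series (DLMF 10.49.6). *)
Definition spherical_hankel1 (n : nat) (z : C) : C :=
  ((- Ci) ^ S n * (Cexp (Ci * z) / z) *
   Csum (fun m =>
     RtoC (INR (fact (n + m)) / (INR (fact m) * INR (fact (n - m)))) *
     (Ci / (RtoC 2 * z)) ^ m) 0 n)%C.

(* q-th derivative of the Legendre polynomial P_n, from Rodrigues' formula
   P_n(t) = 1 / (2^n n!) (d/dt)^n (t^2 - 1)^n. *)
Definition legendre_derive (n q : nat) (t : R) : R :=
  Derive_n (fun s => (s ^ 2 - 1) ^ n) (n + q) t / (2 ^ n * INR (fact n)).

(* At the unit vector xi with polar angles (theta, phi),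
   Y_n^m = N_{n,|m|} (sin theta)^|m| P_n^{(|m|)}(cos theta) e^{i m phi}, |m| <= n,
   where (sin theta)^|m| e^{i m phi} = (xi_1 +/- i xi_2)^|m|, with the sign of m. *)
Definition spherical_harmonic (n : nat) (m : Z) (xi : R3) : C :=
  let q := Z.abs_nat m in
  let N := sqrt ((2 * INR n + 1) / (4 * PI) * (INR (fact (n - q)) / INR (fact (n + q)))) in
  let xi1 := fst (fst xi) in
  let xi2 := snd (fst xi) in
  let w : C := if (0 <=? m)%Z then (xi1, xi2) else (xi1, - xi2) in
  (RtoC (N * legendre_derive n q (snd xi)) * w ^ q)%C.

Definition unit_vector (x : R3) : R3 :=
  (fst (fst x) / norm3 x, snd (fst x) / norm3 x, snd x / norm3 x).

Definition outgoing (Omega : R3 -> Prop) (k : C) (v : R3 -> C) : Prop :=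
  exists (r0 : R) (a : nat -> Z -> C),
    (forall y, closure3 Omega y -> norm3 y < r0) /\
    forall x, r0 < norm3 x ->
      @is_series C_AbsRing C_NormedModule
        (fun n =>
           Csum (fun l =>
             let m := (Z.of_nat l - Z.of_nat n)%Z in
             (a n m * spherical_hankel1 n (k * RtoC (norm3 x)) *
              spherical_harmonic n m (unit_vector x))%C) 0 (2 * n))
        (v x).

(* Classical outgoing solution: C^2 in the exterior, with the Dirichlet data attained
   continuously. *)
Definition exterior_solution (Omega : R3 -> Prop) (k : C) (g v : R3 -> C) : Prop :=
  C2_on (exterior Omega) v /\
  (forall x, exterior Omega x -> (laplacian v x + k ^ 2 * v x = 0)%C) /\
  (forall y, boundary Omega y ->
     filterlim v (within (exterior Omega) (locally y)) (locally (g y))) /\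
  outgoing Omega k v.

(** * Meromorphic operator-valued functions

    Dirichlet data are taken in C(Gamma) with the supremum norm, Gamma being the boundary
    of Omega, and operators map C(Gamma) to C(Omega^+) with the topology of uniform
    convergence on compact sets. Functions on Gamma and on Omega^+ are represented by
    functions on R^3 whose values elsewhere are irrelevant. *)

Definition bounded_linear (Omega : R3 -> Prop) (A : (R3 -> C) -> R3 -> C) : Prop :=
  (forall g, continuous_on (boundary Omega) g -> continuous_on (exterior Omega) (A g)) /\
  (forall (a : C) (g h : R3 -> C) x,
     continuous_on (boundary Omega) g -> continuous_on (boundary Omega) h ->
     exterior Omega x ->
     A (fun y => (a * g y + h y)%C) x = (a * A g x + A h x)%C) /\
  (forall K, compact_subset K (exterior Omega) ->
     exists M, forall (g : R3 -> C) b,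
       continuous_on (boundary Omega) g ->
       (forall y, boundary Omega y -> Cmod (g y) <= b) ->
       forall x, K x -> Cmod (A g x) <= M * b).

(* T = sum_j c_j A_j in the operator topology. *)
Definition operator_series (Omega : R3 -> Prop) (c : nat -> C)
    (A : nat -> (R3 -> C) -> R3 -> C) (T : (R3 -> C) -> R3 -> C) : Prop :=
  forall K, compact_subset K (exterior Omega) ->
  forall eps, 0 < eps ->
  exists J0, forall J, (J0 <= J)%nat ->
  forall (g : R3 -> C) b, continuous_on (boundary Omega) g ->
    (forall y, boundary Omega y -> Cmod (g y) <= b) ->
    forall x, K x ->
      Cmod (T g x - Csum (fun j => (c j * A j g x)%C) 0 J) <= eps * b.

(* B(k) = sum_{j >= 0} (k - p)^{j-m} A_j for 0 < |k - p| < r, and also at k = p if m = 0. *)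
Definition laurent_expansion (Omega : R3 -> Prop) (B : C -> (R3 -> C) -> R3 -> C)
    (p : C) (m : nat) (A : nat -> (R3 -> C) -> R3 -> C) (r : R) : Prop :=
  0 < r /\
  (forall j, bounded_linear Omega (A j)) /\
  forall k : C, Cmod (k - p) < r -> (k <> p \/ m = 0%nat) ->
    operator_series Omega (fun j => ((k - p) ^ j / (k - p) ^ m)%C) A (B k).

Definition operator_analytic_at (Omega : R3 -> Prop) (B : C -> (R3 -> C) -> R3 -> C)
    (k : C) : Prop :=
  exists A r, laurent_expansion Omega B k 0 A r.

Definition is_pole (Omega : R3 -> Prop) (B : C -> (R3 -> C) -> R3 -> C) (p : C) : Prop :=
  exists m A r, (1 <= m)%nat /\ laurent_expansion Omega B p m A r /\
    exists g x, continuous_on (boundary Omega) g /\ exterior Omega x /\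
      A 0%nat g x <> RtoC 0.

Definition operator_meromorphic (Omega : R3 -> Prop) (B : C -> (R3 -> C) -> R3 -> C) : Prop :=
  forall k, operator_analytic_at Omega B k \/ is_pole Omega B k.

(* The Hankel functions are singular at 0, so the outgoing expansion has no meaning for
   k = 0; there a meromorphic B without a pole at 0 is fixed by analytic continuation.
   Solvability for every g in C(Gamma) is where the regularity of the boundary enters. *)
Definition solution_operator (Omega : R3 -> Prop) (B : C -> (R3 -> C) -> R3 -> C) : Prop :=
  forall k, k <> RtoC 0 -> ~ is_pole Omega B k ->
  forall g, continuous_on (boundary Omega) g ->
  forall v, exterior_solution Omega k g v <->
            (forall x, exterior Omega x -> v x = B k g x).

(** * Convolution quadrature *)

(* gamma(z) = sum_n gamma_n z^n, where gamma_n = 0 for n > d. *)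
Definition gamma (gam : nat -> C) (d : nat) (z : C) : C :=
  Csum (fun n => (gam n * z ^ n)%C) 0 d.

Definition wavenumber (gam : nat -> C) (d : nat) (c dt : R) (z : C) : C :=
  (Ci * gamma gam d z / RtoC (c * dt))%C.

(* Only the values g(t; x) with t >= 0 and x on the boundary matter. *)
Definition data_coeff (g : R -> R3 -> C) (dt : R) (z : C) (x : R3) (n : nat) : C :=
  (g (INR n * dt)%R x * z ^ n)%C.

Definition data_transform (g : R -> R3 -> C) (dt : R) (z : C) (x : R3) : C :=
  CSeries (data_coeff g dt z x).

(* Analyticity at z0 of z |-> F(z; .) as a C(Gamma)-valued function. *)
Definition boundary_analytic_at (Omega : R3 -> Prop) (F : C -> R3 -> C) (z0 : C) : Prop :=
  exists (a : nat -> R3 -> C) (r : R),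
    0 < r /\
    (forall j, continuous_on (boundary Omega) (a j)) /\
    forall z : C, Cmod (z - z0) < r ->
    forall eps, 0 < eps ->
    exists J0, forall J, (J0 <= J)%nat ->
    forall y, boundary Omega y ->
      Cmod (F z y - Csum (fun j => (a j y * (z - z0) ^ j)%C) 0 J) <= eps.

Definition data_analytic_on_disc (Omega : R3 -> Prop) (g : R -> R3 -> C) (dt r : R) : Prop :=
  forall z : C, Cmod z < r ->
    (forall y, boundary Omega y -> Cconverges (data_coeff g dt z y)) /\
    boundary_analytic_at Omega (data_transform g dt) z.

Definition lambda_G (Omega : R3 -> Prop) (g : R -> R3 -> C) (dt : R) : Rbar :=
  Lub_Rbar (data_analytic_on_disc Omega g dt).

(* The poles of a meromorphic function are discrete and gamma is a nonconstant polynomial,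
   so this infimum is a minimum unless the set is empty, in which case it is p_infty. *)
Definition lambda_B (Omega : R3 -> Prop) (B : C -> (R3 -> C) -> R3 -> C)
    (gam : nat -> C) (d : nat) (c dt : R) : Rbar :=
  Glb_Rbar (fun r => exists z, is_pole Omega B (wavenumber gam d c dt z) /\ r = Cmod z).

Definition lambda_U (Omega : R3 -> Prop) (B : C -> (R3 -> C) -> R3 -> C)
    (gam : nat -> C) (d : nat) (c dt : R) (g : R -> R3 -> C) : Rbar :=
  Rbar_min (lambda_B Omega B gam d c dt) (lambda_G Omega g dt).

Definition U_d (B : C -> (R3 -> C) -> R3 -> C) (gam : nat -> C) (d : nat) (c dt : R)
    (g : R -> R3 -> C) (z : C) (x : R3) : C :=
  B (wavenumber gam d c dt z) (data_transform g dt z) x.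

(* Contour formula for u_d(t_n; x), with U standing for U_d(.; x). *)
Definition u_contour (U : C -> C) (lambda : R) (n : nat) : C :=
  (/ (RtoC (2 * PI) * Ci) * circle_integral (fun z => U z / z ^ S n) lambda)%C.

(* The points lambda e^{2 pi i k / N}. *)
Definition node (lambda : R) (N k : nat) : C :=
  (RtoC lambda * Cexp (Ci * RtoC (2 * PI * INR k / INR N)))%C.

Definition u_quadrature (U : C -> C) (lambda : R) (N n : nat) : C :=
  (/ RtoC (INR N) * Csum (fun k => U (node lambda N k) / (node lambda N k) ^ n) 1 N)%C.

(* Main.v *)
Require Import Defs.
From Stdlib Require Import Reals Lra Lia ClassicalEpsilon.
From Coquelicot Require Import Coquelicot.
Open Scope R_scope.

(** Inside |z| < lambda_U the wavenumber k_z avoids the scattering poles, so expanding the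
    operator around k_z and the data around z shows that U = U_d(.; x) is holomorphic there.
    For lambda < r < lambda_U, Cauchy's formula on |z| = r at each of the N nodes, together with
    a partial fraction identity, writes the quadrature as
      1/(2 pi i) int_{|z|=r} U(z) z^{N-1-n} / (z^N - lambda^N) dz      (n < N).
    Moving the contour of u_d(t_n; x) to |z| = r as well, the error is the integral of
    U(z) z^{-n-1} lambda^N / (z^N - lambda^N), which is O((lambda/r)^N). It remains to take
    r >= lambda_U - eps lambda.

    Cauchy's formula and the invariance of the contour both come from one observation: for a
    closed curve k avoiding 0, the integral of F(w + s k) k'/k does not depend on s. *)

(** * Strict complex differentiability *)

(** Differentiating under the integral sign requires a continuous derivative, while holomorphy is
    available only through two local expansions: [B] as a series of operators, uniform over data
    with a common bound, and the transform of the data as a series in C(Gamma). Operator and datum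
    both move with z, so a derivative of k -> B(k) f for each fixed f would not suffice: every
    estimate has to be uniform in the datum. This uniformity comes from bounds K / rho^j on the
    coefficients, obtained without contour integrals: if the series converges at one point at
    distance rho from the centre, its terms there are bounded. Such bounds give a first-order
    estimate for the difference of values at two points near the centre, which is exactly strict
    differentiability. The same notion is thus what the expansions deliver and what the contour
    argument consumes. *)

(* In this two-point form the derivative is automatically continuous where it exists. *)
Definition strict_derive (F : C -> C) (z l : C) : Prop :=
  forall eps, 0 < eps -> exists delta, 0 < delta /\
    forall y y' : C, Cmod (y - z) < delta -> Cmod (y' - z) < delta ->
      Cmod (F y - F y' - l * (y - y')) <= eps * Cmod (y - y').

Lemma Cmod_minus_sym (a b : C) : Cmod (a - b) = Cmod (b - a).
Proof. rewrite <- Cmod_opp; f_equal; ring. Qed.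

Lemma Cmod_minus_self (a : C) : Cmod (a - a) = 0.
Proof. replace (a - a)%C with (RtoC 0) by ring; apply Cmod_0. Qed.

Lemma strict_derive_lipschitz (F : C -> C) (z l : C) :
  strict_derive F z l -> exists delta, 0 < delta /\
    forall y y' : C, Cmod (y - z) < delta -> Cmod (y' - z) < delta ->
      Cmod (F y - F y') <= (Cmod l + 1) * Cmod (y - y').
Proof.
  intros H; destruct (H 1 Rlt_0_1) as [d [Hd K]]; exists d; split; [exact Hd|].
  intros y y' Hy Hy'; specialize (K y y' Hy Hy').
  replace (F y - F y')%C with (l * (y - y') + (F y - F y' - l * (y - y')))%C by ring.
  eapply Rle_trans; [apply Cmod_triangle|]; rewrite Cmod_mult; lra.
Qed.

Lemma strict_derive_continuous (F : C -> C) (z l : C) :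
  strict_derive F z l -> forall eps, 0 < eps -> exists delta, 0 < delta /\
    forall y : C, Cmod (y - z) < delta -> Cmod (F y - F z) < eps.
Proof.
  intros H eps He; destruct (strict_derive_lipschitz _ _ _ H) as [d [Hd K]].
  assert (Hl := Cmod_ge_0 l).
  assert (He' : 0 < eps / (Cmod l + 1)) by (apply Rdiv_lt_0_compat; lra).
  exists (Rmin d (eps / (Cmod l + 1))); split; [apply Rmin_glb_lt; lra|].
  intros y Hy.
  assert (H1 := Rmin_l d (eps / (Cmod l + 1))); assert (H2 := Rmin_r d (eps / (Cmod l + 1))).
  eapply Rle_lt_trans.
  { apply K; [lra | rewrite Cmod_minus_self; lra]. }
  apply Rlt_le_trans with ((Cmod l + 1) * (eps / (Cmod l + 1))).
  - apply Rmult_lt_compat_l; lra.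
  - right; field; lra.
Qed.

Lemma Cmod_le_plus (a b : C) : Cmod a <= Cmod b + Cmod (a - b).
Proof.
  replace a with (b + (a - b))%C at 1 by ring; apply Cmod_triangle.
Qed.

Lemma strict_derive_const (c z : C) : strict_derive (fun _ => c) z 0.
Proof.
  intros eps He; exists 1; split; [lra|]; intros y y' _ _.
  replace (c - c - 0 * (y - y'))%C with (RtoC 0) by ring.
  rewrite Cmod_0; apply Rmult_le_pos; [lra | apply Cmod_ge_0].
Qed.

Lemma strict_derive_id (z : C) : strict_derive (fun y => y) z 1.
Proof.
  intros eps He; exists 1; split; [lra|]; intros y y' _ _.
  replace (y - y' - 1 * (y - y'))%C with (RtoC 0) by ring.
  rewrite Cmod_0; apply Rmult_le_pos; [lra | apply Cmod_ge_0].
Qed.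

Lemma strict_derive_plus (F G : C -> C) (z l m : C) :
  strict_derive F z l -> strict_derive G z m ->
  strict_derive (fun y => F y + G y)%C z (l + m).
Proof.
  intros HF HG eps He.
  destruct (HF (eps / 2)) as [d1 [Hd1 K1]]; [lra|].
  destruct (HG (eps / 2)) as [d2 [Hd2 K2]]; [lra|].
  assert (M1 := Rmin_l d1 d2); assert (M2 := Rmin_r d1 d2).
  exists (Rmin d1 d2); split; [apply Rmin_glb_lt; lra|]; intros y y' Hy Hy'.
  replace (F y + G y - (F y' + G y') - (l + m) * (y - y'))%C with
    ((F y - F y' - l * (y - y')) + (G y - G y' - m * (y - y')))%C by ring.
  eapply Rle_trans; [apply Cmod_triangle|].
  specialize (K1 y y'); specialize (K2 y y'); lra.
Qed.

Lemma strict_derive_mult (F G : C -> C) (z l m : C) :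
  strict_derive F z l -> strict_derive G z m ->
  strict_derive (fun y => F y * G y)%C z (l * G z + F z * m).
Proof.
  intros HF HG eps He.
  assert (Pl := Cmod_ge_0 l); assert (Pm := Cmod_ge_0 m).
  assert (PF := Cmod_ge_0 (F z)); assert (PG := Cmod_ge_0 (G z)).
  (* With tolerance e <= 1 the values of F and G near z exceed those at z by at most 1 in modulus,
     and the four error terms below add up to e S |y - y'|. The 2 collects these two units. *)
  set (S := Cmod (G z) + Cmod (F z) + Cmod l + Cmod m + 2).
  assert (HS : 0 < S) by (unfold S; lra).
  set (e := Rmin 1 (eps / S)).
  assert (He0 : 0 < e) by (apply Rmin_glb_lt; [lra | apply Rdiv_lt_0_compat; lra]).
  assert (He1 : e <= 1) by apply Rmin_l.
  assert (HeS : e * S <= eps).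
  { replace eps with (eps / S * S) by (field; lra).
    apply Rmult_le_compat_r; [lra | apply Rmin_r]. }
  destruct (HF e He0) as [d1 [Hd1 K1]], (HG e He0) as [d2 [Hd2 K2]].
  destruct (strict_derive_continuous _ _ _ HF e He0) as [d3 [Hd3 K3]].
  destruct (strict_derive_continuous _ _ _ HG e He0) as [d4 [Hd4 K4]].
  set (d := Rmin (Rmin d1 d2) (Rmin d3 d4)).
  assert (d <= Rmin d1 d2) by apply Rmin_l. assert (d <= Rmin d3 d4) by apply Rmin_r.
  assert (Rmin d1 d2 <= d1) by apply Rmin_l. assert (Rmin d1 d2 <= d2) by apply Rmin_r.
  assert (Rmin d3 d4 <= d3) by apply Rmin_l. assert (Rmin d3 d4 <= d4) by apply Rmin_r.
  exists d; split; [repeat apply Rmin_glb_lt; assumption|].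
  intros y y' Hy Hy'.
  assert (k1 : Cmod (F y - F y' - l * (y - y')) <= e * Cmod (y - y')) by (apply K1; lra).
  assert (k2 : Cmod (G y - G y' - m * (y - y')) <= e * Cmod (y - y')) by (apply K2; lra).
  assert (k3 : Cmod (F y' - F z) < e) by (apply K3; lra).
  assert (k4 : Cmod (G y - G z) < e) by (apply K4; lra).
  assert (gF := Cmod_le_plus (F y') (F z)); assert (gG := Cmod_le_plus (G y) (G z)).
  replace (F y * G y - F y' * G y' - (l * G z + F z * m) * (y - y'))%C with
    ((F y - F y' - l * (y - y')) * G y + l * (y - y') * (G y - G z)
     + (F y' * (G y - G y' - m * (y - y')) + (F y' - F z) * (m * (y - y'))))%C by ring.
  set (h := Cmod (y - y')) in *. assert (Ph : 0 <= h) by apply Cmod_ge_0.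
  eapply Rle_trans; [apply Cmod_triangle|].
  eapply Rle_trans; [apply Rplus_le_compat; apply Cmod_triangle|].
  rewrite !Cmod_mult; fold h.
  apply Rle_trans with (e * h * (Cmod (G z) + 1) + Cmod l * h * e
     + ((Cmod (F z) + 1) * (e * h) + e * (Cmod m * h))).
  - repeat apply Rplus_le_compat; apply Rmult_le_compat; try apply Cmod_ge_0; try lra;
      repeat apply Rmult_le_pos; try apply Cmod_ge_0; lra.
  - replace (e * h * (Cmod (G z) + 1) + Cmod l * h * e
     + ((Cmod (F z) + 1) * (e * h) + e * (Cmod m * h))) with (e * S * h) by (unfold S; ring).
    apply Rmult_le_compat_r; lra.
Qed.

Lemma strict_derive_inv (z : C) : z <> RtoC 0 -> strict_derive Cinv z (- / (z * z))%C.
Proof.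
  intros Hz eps He.
  assert (Pz : 0 < Cmod z) by (apply Cmod_gt_0, Hz).
  set (r := Cmod z) in *.
  (* The error is |y - y'| |y y' - z^2| / (|z|^2 |y y'|), where y y' - z^2 = y (y' - z) + z (y - z).
     For d <= r/2 one has r/2 <= |y|, |y'| and |y| <= 2r, so the quotient is at most 3 r d / (r^4 /
     4) = 12 d / r^3. *)
  set (d := Rmin (r / 2) (eps * (r * r * r) / 12)).
  assert (Hr3 : 0 < r * r * r) by (repeat apply Rmult_lt_0_compat; lra).
  assert (D1 : d <= r / 2) by apply Rmin_l.
  assert (D2 : d <= eps * (r * r * r) / 12) by apply Rmin_r.
  assert (Hd : 0 < d).
  { apply Rmin_glb_lt; [lra|].
    apply Rdiv_lt_0_compat; [apply Rmult_lt_0_compat|]; lra. }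
  exists d; split; [exact Hd|]; intros y y' Hy Hy'.
  assert (gy := Cmod_le_plus z y); assert (gy' := Cmod_le_plus z y').
  assert (uy := Cmod_le_plus y z).
  rewrite (Cmod_minus_sym z y) in gy; rewrite (Cmod_minus_sym z y') in gy'.
  fold r in gy, gy', uy.
  assert (Hy0 : y <> RtoC 0) by (apply Cmod_gt_0; lra).
  assert (Hy0' : y' <> RtoC 0) by (apply Cmod_gt_0; lra).
  replace (/ y - / y' - - / (z * z) * (y - y'))%C with
    ((y - y') * ((y * (y' - z) + z * (y - z)) / (z * z * (y * y'))))%C
    by (field; repeat split; assumption).
  rewrite Cmod_mult, Rmult_comm; apply Rmult_le_compat_r; [apply Cmod_ge_0|].
  rewrite Cmod_div by (repeat apply Cmult_neq_0; assumption).
  rewrite !Cmod_mult; fold r.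
  apply Rle_trans with (3 * r * d / (r * r * (r / 2 * (r / 2)))).
  - apply Rmult_le_compat.
    + apply Cmod_ge_0.
    + left; apply Rinv_0_lt_compat; repeat apply Rmult_lt_0_compat; lra.
    + eapply Rle_trans; [apply Cmod_triangle|]; rewrite !Cmod_mult; fold r.
      apply Rle_trans with (2 * r * d + r * d); [|right; ring].
      apply Rplus_le_compat; apply Rmult_le_compat; try apply Cmod_ge_0; lra.
    + apply Rinv_le_contravar; [repeat apply Rmult_lt_0_compat; lra|].
      apply Rmult_le_compat_l; [apply Rmult_le_pos; lra|].
      apply Rmult_le_compat; lra.
  - apply Rle_trans with (3 * r * (eps * (r * r * r) / 12) / (r * r * (r / 2 * (r / 2)))).
    + apply Rmult_le_compat_r.
      * left; apply Rinv_0_lt_compat; repeat apply Rmult_lt_0_compat; lra.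
      * apply Rmult_le_compat_l; lra.
    + right; field; lra.
Qed.

Lemma strict_derive_ext (F G : C -> C) (z l : C) :
  (forall y, F y = G y) -> strict_derive F z l -> strict_derive G z l.
Proof.
  intros E H eps He; destruct (H eps He) as [d [Hd K]]; exists d; split; [exact Hd|].
  intros y y'; rewrite <- !E; apply K.
Qed.

Lemma strict_derive_pow (F : C -> C) (z l : C) (n : nat) :
  strict_derive F z l -> exists m, strict_derive (fun y => F y ^ n)%C z m.
Proof.
  intros H; induction n as [|n [m IH]].
  - exists (RtoC 0); exact (strict_derive_const 1 z).
  - eexists; exact (strict_derive_mult _ _ _ _ _ H IH).
Qed.

Lemma strict_derive_comp (F G : C -> C) (z l m : C) :
  strict_derive G z m -> strict_derive F (G z) l ->
  strict_derive (fun y => F (G y)) z (l * m).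
Proof.
  intros HG HF eps He.
  assert (Pl := Cmod_ge_0 l); assert (Pm := Cmod_ge_0 m).
  assert (HE : 0 < eps / (2 * (Cmod m + 1))) by (apply Rdiv_lt_0_compat; lra).
  assert (HE' : 0 < eps / (2 * (Cmod l + 1))) by (apply Rdiv_lt_0_compat; lra).
  destruct (HF _ HE) as [d1 [Hd1 K1]], (HG _ HE') as [d2 [Hd2 K2]].
  destruct (strict_derive_continuous _ _ _ HG d1 Hd1) as [d3 [Hd3 K3]].
  destruct (strict_derive_lipschitz _ _ _ HG) as [d4 [Hd4 K4]].
  set (d := Rmin d2 (Rmin d3 d4)).
  assert (d <= d2) by apply Rmin_l. assert (d <= Rmin d3 d4) by apply Rmin_r.
  assert (Rmin d3 d4 <= d3) by apply Rmin_l. assert (Rmin d3 d4 <= d4) by apply Rmin_r.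
  exists d; split; [repeat apply Rmin_glb_lt; assumption|].
  intros y y' Hy Hy'.
  replace (F (G y) - F (G y') - l * m * (y - y'))%C with
    ((F (G y) - F (G y') - l * (G y - G y')) + l * (G y - G y' - m * (y - y')))%C by ring.
  eapply Rle_trans; [apply Cmod_triangle|]; rewrite Cmod_mult.
  assert (k1 := K1 (G y) (G y') (K3 y ltac:(lra)) (K3 y' ltac:(lra))).
  assert (k2 := K2 y y' ltac:(lra) ltac:(lra)).
  assert (k4 := K4 y y' ltac:(lra) ltac:(lra)).
  set (h := Cmod (y - y')) in *. assert (Ph : 0 <= h) by apply Cmod_ge_0.
  apply Rle_trans with (eps / (2 * (Cmod m + 1)) * ((Cmod m + 1) * h)
    + (Cmod l + 1) * (eps / (2 * (Cmod l + 1)) * h)).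
  - apply Rplus_le_compat.
    + eapply Rle_trans; [exact k1|]; apply Rmult_le_compat_l; lra.
    + apply Rmult_le_compat; try apply Cmod_ge_0; lra.
  - right; field; lra.
Qed.

(** The pair (y + t, y) with small t > 0 lies both in the neighbourhood of z where [l] approximates
    the difference quotients and in the one of y where [l'] does. Subtracting the two estimates
    gives |l' - l| t <= (2/3) eps t. *)
Lemma strict_derive_derivative_continuous (F : C -> C) (z l : C) :
  strict_derive F z l ->
  forall eps, 0 < eps -> exists delta, 0 < delta /\
    forall y l' : C, Cmod (y - z) < delta -> strict_derive F y l' -> Cmod (l' - l) < eps.
Proof.
  intros H eps He.
  destruct (H (eps / 3)) as [d [Hd K]]; [lra|].
  exists d; split; [exact Hd|]; intros y l' Hy Hl'.
  destruct (Hl' (eps / 3)) as [d' [Hd' K']]; [lra|].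
  set (t := Rmin (d' / 2) ((d - Cmod (y - z)) / 2)).
  assert (T1 : t <= d' / 2) by apply Rmin_l.
  assert (T2 : t <= (d - Cmod (y - z)) / 2) by apply Rmin_r.
  assert (Ht : 0 < t) by (apply Rmin_glb_lt; lra).
  assert (E : Cmod (y + t - y) = t).
  { replace (y + t - y)%C with (RtoC t) by ring; rewrite Cmod_R; apply Rabs_pos_eq; lra. }
  assert (k := K (y + t)%C y).
  assert (k' := K' (y + t)%C y).
  rewrite E, Cmod_minus_self in k'; rewrite E in k.
  assert (Cmod (y + t - z) < d).
  { replace (y + t - z)%C with (y - z + t)%C by ring.
    eapply Rle_lt_trans; [apply Cmod_triangle|]; rewrite Cmod_R, (Rabs_pos_eq t); lra. }
  specialize (k ltac:(lra) ltac:(lra)); specialize (k' ltac:(lra) ltac:(lra)).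
  apply Rmult_lt_reg_r with t; [lra|].
  rewrite <- E at 1; rewrite <- Cmod_mult.
  replace ((l' - l) * (y + t - y))%C with
    ((F (y + t) - F y - l * (y + t - y)) - (F (y + t) - F y - l' * (y + t - y)))%C by ring.
  eapply Rle_lt_trans; [apply Cmod_triangle|]; rewrite Cmod_opp.
  assert (0 < eps * t) by (apply Rmult_lt_0_compat; lra). lra.
Qed.

(** * Integrals over closed curves *)

Notation is_derive_C := (@is_derive R_AbsRing C_R_NormedModule).
Notation is_RInt_C := (@is_RInt C_R_NormedModule).

Lemma scal_R_C (s : R) (z : C) : @scal R_AbsRing C_R_ModuleSpace s z = (RtoC s * z)%C.
Proof. destruct z as [x y]; apply injective_projections; cbn; unfold mult; cbn; ring. Qed.

Lemma is_linear_C_mult (l : C) : @is_linear R_AbsRing C_R_NormedModule C_R_NormedModule (Cmult l).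
Proof.
  split.
  - intros x y; apply Cmult_plus_distr_l.
  - intros k x; rewrite !scal_R_C; change (l * (k * x) = k * (l * x))%C; ring.
  - exists (Cmod l + 1); split; [assert (H := Cmod_ge_0 l); lra|].
    intros x; rewrite <- !Cmod_norm, Cmod_mult; apply Rmult_le_compat_r; [apply Cmod_ge_0 | lra].
Qed.

Lemma is_linear_Re : @is_linear R_AbsRing C_R_NormedModule R_NormedModule Re.
Proof. exact (@is_linear_fst R_AbsRing R_NormedModule R_NormedModule). Qed.

Lemma is_linear_Im : @is_linear R_AbsRing C_R_NormedModule R_NormedModule Im.
Proof. exact (@is_linear_snd R_AbsRing R_NormedModule R_NormedModule). Qed.

Lemma is_derive_linear {U V : NormedModule R_AbsRing} (p : U -> V) (f : R -> U) (t : R) (l : U) :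
  is_linear p -> is_derive f t l -> is_derive (fun u => p (f u)) t (p l).
Proof.
  intros Hp Hf.
  eapply filterdiff_ext_lin; [apply (filterdiff_comp' f p t _ p Hf)|].
  - apply filterdiff_linear, Hp.
  - intros y; cbn; apply (linear_scal p Hp).
Qed.

(** Chain rule between two kinds of derivative: as a map of the real plane F has the real-linear
    differential [Cmult l], which composes with the derivative of a curve. *)
Lemma is_derive_strict (F : C -> C) (f : R -> C) (t : R) (l m : C) :
  strict_derive F (f t) l -> is_derive_C f t m -> is_derive_C (fun u => F (f u)) t (l * m)%C.
Proof.
  intros HF Hf.
  eapply filterdiff_ext_lin; [apply (filterdiff_comp' f F t _ (Cmult l) Hf)|].
  - split; [apply is_linear_C_mult|].
    intros x Hx; apply is_filter_lim_locally_unique in Hx; subst x.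
    intros eps; destruct (HF eps (cond_pos eps)) as [d [Hd K]].
    (* Balls of the product uniform structure on [C] are squares; the one of radius d / sqrt 2 fits
       into the disc of radius d. *)
    exists (mkposreal (d / sqrt 2) ltac:(apply Rdiv_lt_0_compat; [exact Hd | apply sqrt_lt_R0; lra])).
    intros y Hy; apply (C_NormedModule_mixin_compat2 (f t) y) in Hy.
    rewrite <- !Cmod_norm; apply K.
    + eapply Rlt_le_trans; [exact Hy|]; right; cbn; field; apply Rgt_not_eq, sqrt_lt_R0; lra.
    + rewrite Cmod_minus_self; exact Hd.
  - intros y; cbn beta; apply (linear_scal _ (is_linear_C_mult l)).
Qed.

Lemma is_derive_C_mult (c : C) (f : R -> C) (t : R) (l : C) :
  is_derive_C f t l -> is_derive_C (fun u => c * f u)%C t (c * l)%C.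
Proof.
  apply (is_derive_linear (U := C_R_NormedModule) (V := C_R_NormedModule) (Cmult c)),
    is_linear_C_mult.
Qed.

Lemma is_derive_C_shift (w : C) (f : R -> C) (t : R) (l : C) :
  is_derive_C f t l -> is_derive_C (fun u => w + f u)%C t l.
Proof.
  intros H; rewrite <- (plus_zero_l (G := C_R_NormedModule) l).
  apply (is_derive_plus (V := C_R_NormedModule)); [|exact H].
  apply (is_derive_const (V := C_R_NormedModule)).
Qed.

Lemma is_derive_C_pair (f g : R -> R) (t l m : R) :
  is_derive f t l -> is_derive g t m -> is_derive_C (fun u => (f u, g u)) t (l, m).
Proof.
  intros Hf Hg.
  apply (filterdiff_comp'_2 f g (fun a b => (a, b)) t _ _ (fun a b => (a, b)) Hf Hg).
  eapply filterdiff_ext; [|eapply filterdiff_ext_lin; [apply filterdiff_id|]];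
    intros [a b]; reflexivity.
Qed.

Lemma continuous_C_iff {T : UniformSpace} (f : T -> C) (x : T) :
  continuous f x <-> forall eps, 0 < eps -> locally x (fun y => Cmod (f y - f x) < eps).
Proof.
  split; intros H.
  - intros eps He.
    assert (He' : 0 < eps / sqrt 2) by (apply Rdiv_lt_0_compat; [exact He | apply sqrt_lt_R0; lra]).
    generalize (proj1 (filterlim_locally f (f x)) H (mkposreal _ He')); apply filter_imp; intros y Hy.
    apply (C_NormedModule_mixin_compat2 (f x) (f y)) in Hy.
    eapply Rlt_le_trans; [exact Hy|]; right; cbn; field; apply Rgt_not_eq, sqrt_lt_R0; lra.
  - apply filterlim_locally; intros eps; generalize (H eps (cond_pos eps)).
    apply filter_imp; intros y Hy.
    apply (C_NormedModule_mixin_compat1 (f x) (f y) eps Hy).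
Qed.

Lemma continuous_C_components {T : UniformSpace} (f : T -> C) (x : T) :
  continuous (fun y => Re (f y)) x -> continuous (fun y => Im (f y)) x -> continuous f x.
Proof.
  intros H1 H2; apply filterlim_locally; intros eps.
  generalize (filter_and _ _ (proj1 (filterlim_locally _ _) H1 eps) (proj1 (filterlim_locally _ _) H2 eps)).
  apply filter_imp; intros y [K1 K2]; split; assumption.
Qed.

Lemma continuous_Re {T : UniformSpace} (f : T -> C) (x : T) :
  continuous f x -> continuous (fun y => Re (f y)) x.
Proof. intros H; apply (continuous_comp f Re); [exact H|]; destruct (f x); apply continuous_fst. Qed.

Lemma continuous_Im {T : UniformSpace} (f : T -> C) (x : T) :
  continuous f x -> continuous (fun y => Im (f y)) x.
Proof. intros H; apply (continuous_comp f Im); [exact H|]; destruct (f x); apply continuous_snd. Qed.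

Lemma continuous_Cmult {T : UniformSpace} (f g : T -> C) (x : T) :
  continuous f x -> continuous g x -> continuous (fun y => f y * g y)%C x.
Proof.
  intros Hf Hg.
  assert (f1 := continuous_Re _ _ Hf); assert (f2 := continuous_Im _ _ Hf).
  assert (g1 := continuous_Re _ _ Hg); assert (g2 := continuous_Im _ _ Hg).
  apply continuous_C_components; cbn.
  - apply (continuous_minus (V := R_NormedModule));
      apply (continuous_mult (K := R_AbsRing)); assumption.
  - apply (continuous_plus (V := R_NormedModule));
      apply (continuous_mult (K := R_AbsRing)); assumption.
Qed.

Lemma continuous_strict {T : UniformSpace} (F : C -> C) (f : T -> C) (x : T) (l : C) :
  strict_derive F (f x) l -> continuous f x -> continuous (fun y => F (f y)) x.
Proof.
  intros HF Hf; apply continuous_C_iff; intros eps He.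
  destruct (strict_derive_continuous _ _ _ HF eps He) as [d [Hd K]].
  generalize (proj1 (continuous_C_iff f x) Hf d Hd); apply filter_imp; intros y; apply K.
Qed.

Lemma continuous_Cinv {T : UniformSpace} (f : T -> C) (x : T) :
  f x <> RtoC 0 -> continuous f x -> continuous (fun y => / f y)%C x.
Proof. intros H; apply (continuous_strict Cinv f x _ (strict_derive_inv _ H)). Qed.

Lemma is_derive_C_continuous (f : R -> C) (t : R) (l : C) : is_derive_C f t l -> continuous f t.
Proof.
  intros H; apply (ex_derive_continuous (V := C_R_NormedModule)); exists l; exact H.
Qed.

(* The s-derivative of the integrand, F'(w + s k) k', is 1/s times the t-derivative of
   F(w + s k), so it integrates to zero along the closed curve k. *)
Lemma radial_invariance_linear (p : C -> R) (F F' : C -> C) (w : C) (k k' : R -> C) (a b delta : R) :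
  is_linear (U := C_R_NormedModule) (V := R_NormedModule) p ->
  0 <= a -> a < b -> 0 < delta ->
  (forall t, is_derive_C k t (k' t)) -> (forall t, continuous k' t) ->
  (forall t, k t <> RtoC 0) -> k (2 * PI) = k 0 ->
  (forall s t : R, a - delta < s < b + delta ->
     strict_derive F (w + s * k t) (F' (w + s * k t))%C) ->
  RInt (fun t => p (F (w + a * k t) * (k' t / k t))%C) 0 (2 * PI) =
  RInt (fun t => p (F (w + b * k t) * (k' t / k t))%C) 0 (2 * PI).
Proof.
  intros Hp Ha Hab Hd Hk Hk' Hk0 Hcl HF.
  set (H := fun s t : R => (w + s * k t)%C).
  assert (Hs : forall s t, is_derive_C (fun u => H u t) s (k t)).
  { intros s t; apply is_derive_C_shift.
    apply (is_derive_ext (V := C_R_NormedModule) (fun u => (k t * u)%C)).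
    - intros u; apply Cmult_comm.
    - apply (eq_ind _ (is_derive_C (fun u : R => (k t * u)%C) s)) with (2 := Cmult_1_r (k t)).
      apply is_derive_C_mult, is_derive_C_pair.
      + apply (is_derive_id (K := R_AbsRing)).
      + apply (is_derive_const (K := R_AbsRing) (V := R_NormedModule)). }
  assert (Ht : forall s t, is_derive_C (fun u => H s u) t (s * k' t)%C).
  { intros s t; apply is_derive_C_shift, is_derive_C_mult, Hk. }
  assert (Hkc : forall t, continuous k t) by (intros t; apply (is_derive_C_continuous _ _ _ (Hk t))).
  assert (HHc : forall s t, continuous (fun q : R * R => H (fst q) (snd q)) (s, t)).
  { intros s t; apply (continuous_plus (V := C_R_NormedModule)); [apply continuous_const|].
    apply continuous_Cmult.
    - apply continuous_C_components; cbn; [apply continuous_fst | apply continuous_const].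
    - apply (continuous_comp snd k); [apply continuous_snd | apply Hkc]. }
  assert (pc : forall (T : UniformSpace) (f : T -> C) (x : T), continuous f x ->
            continuous (fun y => p (f y)) x).
  { intros T f x Hf; apply (continuous_comp f p); [exact Hf|].
    apply (filterdiff_continuous (U := C_R_NormedModule) (V := R_NormedModule) p).
    exists p; apply filterdiff_linear, Hp. }
  (* The s-derivative of w + s k is k, which cancels the denominator of k'/k and leaves F'(w + s k)
     k'. *)
  assert (Hds : forall s t, a - delta < s < b + delta ->
            is_derive (fun u => p (F (H u t) * (k' t / k t))%C) s (p (F' (H s t) * k' t)%C)).
  { intros s t hs.
    apply (is_derive_linear (U := C_R_NormedModule) (V := R_NormedModule) p); [exact Hp|].
    replace (F' (H s t) * k' t)%C with (k' t / k t * (F' (H s t) * k t))%C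
      by (field; apply Hk0).
    eapply (is_derive_ext (V := C_R_NormedModule) (fun u => (k' t / k t * F (H u t))%C)).
    - intros u; apply Cmult_comm.
    - apply is_derive_C_mult.
      apply (is_derive_strict F (fun u => H u t)); [apply HF, hs | apply Hs]. }
  assert (HF'c : forall s t, a - delta < s < b + delta ->
            continuous (fun q : R * R => F' (H (fst q) (snd q))) (s, t)).
  { intros s t hs; apply continuous_C_iff; intros eps He; cbn [fst snd].
    destruct (strict_derive_derivative_continuous _ _ _ (HF s t hs) eps He) as [d [hd K]].
    assert (L1 := proj1 (continuous_C_iff _ _) (HHc s t) d hd).
    assert (L2 : locally (s, t) (fun q : R * R => a - delta < fst q < b + delta)).
    { assert (hm : 0 < Rmin (s - (a - delta)) (b + delta - s)) by (apply Rmin_glb_lt; lra).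
      exists (mkposreal _ hm); intros [u v] [Hu _].
      change (Rabs (u - s) < Rmin (s - (a - delta)) (b + delta - s)) in Hu; cbn [fst].
      assert (m1 := Rmin_l (s - (a - delta)) (b + delta - s)).
      assert (m2 := Rmin_r (s - (a - delta)) (b + delta - s)).
      apply Rabs_def2 in Hu; lra. }
    generalize (filter_and _ _ L1 L2); apply filter_imp; intros [u v] [K1 K2].
    apply (K _ _ K1), HF, K2. }
  assert (Hdc : forall s t, a - delta < s < b + delta ->
            continuous (fun q : R * R => p (F' (H (fst q) (snd q)) * k' (snd q))%C) (s, t)).
  { intros s t hs; apply pc, continuous_Cmult; [apply HF'c, hs|].
    apply (continuous_comp snd k'); [apply continuous_snd | apply Hk']. }
  assert (Hint : forall s, a - delta < s < b + delta ->
            ex_RInt (fun t => p (F (H s t) * (k' t / k t))%C) 0 (2 * PI)).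
  { intros s hs; apply (ex_RInt_continuous (V := R_CompleteNormedModule)); intros t _.
    apply pc, continuous_Cmult.
    - apply (continuous_strict F (H s) t _ (HF s t hs)), (is_derive_C_continuous _ _ _ (Ht s t)).
    - apply continuous_Cmult; [apply Hk' | apply continuous_Cinv; [apply Hk0 | apply Hkc]]. }
  assert (Hdt : forall s t, a - delta < s < b + delta ->
            continuous (fun t => p (F' (H s t) * k' t)%C) t).
  { intros s t hs.
    apply (continuous_comp_2 (fun _ => s) (fun t => t) (fun u v => p (F' (H u v) * k' v)%C));
      [apply continuous_const | apply continuous_id | apply Hdc, hs]. }
  assert (Hnear : forall s, a <= s <= b -> locally s (fun u => a - delta < u < b + delta)).
  { intros s hs; exists (mkposreal _ Hd); intros u hu.
    change (Rabs (u - s) < delta) in hu; apply Rabs_def2 in hu; lra. }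
  set (psi := fun s => RInt (fun t => p (F (H s t) * (k' t / k t))%C) 0 (2 * PI)).
  (* The margin [delta] makes [psi] differentiable on a neighbourhood of each endpoint, so it is
     continuous on the closed interval, as the mean value theorem demands. *)
  assert (Hpsi : forall s, a <= s <= b ->
            is_derive psi s (RInt (fun t => p (F' (H s t) * k' t)%C) 0 (2 * PI))).
  { intros s hs; assert (hs' : a - delta < s < b + delta) by lra.
    replace (RInt (fun t => p (F' (H s t) * k' t)%C) 0 (2 * PI)) with
      (RInt (fun t => Derive (fun u => p (F (H u t) * (k' t / k t))%C) s) 0 (2 * PI))
      by (apply RInt_ext; intros t _; apply is_derive_unique, Hds, hs').
    apply is_derive_RInt_param.
    - generalize (Hnear s hs); apply filter_imp; intros u hu t _.
      eexists; apply Hds, hu.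
    - intros t _; apply continuity_2d_pt_ext_loc with (fun u v => p (F' (H u v) * k' v)%C).
      + destruct (Hnear s hs) as [e He]; exists e; intros u v hu _.
        symmetry; apply is_derive_unique, Hds, He, hu.
      + apply continuity_2d_pt_filterlim, (Hdc s t hs').
    - generalize (Hnear s hs); apply filter_imp; intros u hu; apply Hint, hu. }
  (* Only s times the integrand is an exact t-derivative, so s must not vanish. On the open interval
     s > a >= 0, and the mean value theorem needs no more; this admits a = 0, where the curve has
     collapsed to the point w. *)
  assert (Hzero : forall s, a < s < b -> RInt (fun t => p (F' (H s t) * k' t)%C) 0 (2 * PI) = 0).
  { intros s hs; assert (hs' : a - delta < s < b + delta) by lra.
    apply Rmult_eq_reg_l with s; [|lra]; rewrite Rmult_0_r.
    assert (E : is_RInt (fun t => scal s (p (F' (H s t) * k' t)%C)) 0 (2 * PI) 0).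
    { replace 0 with (minus (p (F (H s (2 * PI)))) (p (F (H s 0)))) at 2
        by (unfold H; rewrite Hcl; apply (minus_eq_zero (G := R_AbelianGroup))).
      apply (is_RInt_derive (V := R_CompleteNormedModule) (fun t => p (F (H s t)))).
      - intros t _; rewrite <- (linear_scal (U := C_R_NormedModule) (V := R_NormedModule) p Hp), scal_R_C.
        replace (s * (F' (H s t) * k' t))%C with (F' (H s t) * (s * k' t))%C by ring.
        apply (is_derive_linear (U := C_R_NormedModule) (V := R_NormedModule) p); [exact Hp|].
        apply (is_derive_strict F (H s)); [apply HF, hs' | apply Ht].
      - intros t _; apply (continuous_scal_r (V := R_NormedModule)), Hdt, hs'. }
    assert (E2 := is_RInt_scal (V := R_NormedModule) _ 0 (2 * PI) s _
      (RInt_correct (V := R_CompleteNormedModule) _ 0 (2 * PI)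
        (ex_RInt_continuous (V := R_CompleteNormedModule) _ 0 (2 * PI) (fun t _ => Hdt s t hs')))).
    apply (is_RInt_unique (V := R_CompleteNormedModule)) in E, E2.
    exact (eq_trans (eq_sym E2) E). }
  change (psi a = psi b).
  destruct (MVT_gen psi a b (fun _ => 0)) as [c [_ E]].
  - intros s; rewrite Rmin_left, Rmax_right by lra; intros hs.
    rewrite <- (Hzero s hs); apply Hpsi; lra.
  - intros s; rewrite Rmin_left, Rmax_right by lra; intros hs.
    apply continuity_pt_filterlim, (ex_derive_continuous psi); eexists; apply Hpsi, hs.
  - lra.
Qed.

(** * Cauchy's formula on circles *)

Lemma is_RInt_C_ext (f g : R -> C) (a b : R) (l : C) :
  (forall t, f t = g t) -> is_RInt_C f a b l -> is_RInt_C g a b l.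
Proof. intros E; apply (is_RInt_ext (V := C_R_NormedModule)); intros t _; apply E. Qed.

Lemma RtoC_neq_0 (r : R) : r <> 0 -> RtoC r <> RtoC 0.
Proof. intros H E; apply H, (RtoC_inj _ _ E). Qed.

Lemma is_RInt_C_mult (c : C) (f : R -> C) (a b : R) (l : C) :
  is_RInt_C f a b l -> is_RInt_C (fun t => c * f t)%C a b (c * l)%C.
Proof.
  intros H.
  assert (H1 := is_RInt_fct_extend_fst (U := R_NormedModule) (V := R_NormedModule) f a b l H).
  assert (H2 := is_RInt_fct_extend_snd (U := R_NormedModule) (V := R_NormedModule) f a b l H).
  apply (is_RInt_fct_extend_pair (U := R_NormedModule) (V := R_NormedModule)); cbn [fst snd].
  - apply (is_RInt_minus (V := R_NormedModule)); apply (is_RInt_scal (V := R_NormedModule)); assumption.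
  - apply (is_RInt_plus (V := R_NormedModule)); apply (is_RInt_scal (V := R_NormedModule)); assumption.
Qed.

Lemma is_RInt_C_components (f : R -> C) (a b : R) (l : C) :
  is_RInt_C f a b l ->
  RInt (fun t => Re (f t)) a b = Re l /\ RInt (fun t => Im (f t)) a b = Im l.
Proof.
  intros H; split; apply (is_RInt_unique (V := R_CompleteNormedModule)).
  - exact (is_RInt_fct_extend_fst (U := R_NormedModule) (V := R_NormedModule) f a b l H).
  - exact (is_RInt_fct_extend_snd (U := R_NormedModule) (V := R_NormedModule) f a b l H).
Qed.

Lemma is_RInt_C_const (c : C) (b : R) : is_RInt_C (fun _ => c) 0 b (RtoC b * c)%C.
Proof.
  apply (is_RInt_fct_extend_pair (U := R_NormedModule) (V := R_NormedModule)); cbn [fst snd Cmult RtoC].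
  - replace (b * fst c - 0 * snd c) with ((b - 0) * fst c) by ring.
    exact (is_RInt_const (V := R_NormedModule) 0 b (fst c)).
  - replace (b * snd c + 0 * fst c) with ((b - 0) * snd c) by ring.
    exact (is_RInt_const (V := R_NormedModule) 0 b (snd c)).
Qed.

(** The theorem on parameter integrals is applied to real-valued integrands, so [p] is taken to be
    [Re] and [Im] and the complex value is reassembled. The form with [is_RInt] carries over the
    integrability together with the value. *)
Lemma radial_invariance (F : C -> C) (w : C) (k k' : R -> C) (a b delta : R) (l : C) :
  0 <= a -> a < b -> 0 < delta ->
  (forall t, is_derive_C k t (k' t)) -> (forall t, continuous k' t) ->
  (forall t, k t <> RtoC 0) -> k (2 * PI) = k 0 ->
  (forall s t : R, a - delta < s < b + delta ->
     exists m, strict_derive F (w + s * k t)%C m) ->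
  is_RInt_C (fun t => F (w + a * k t) * (k' t / k t))%C 0 (2 * PI) l ->
  is_RInt_C (fun t => F (w + b * k t) * (k' t / k t))%C 0 (2 * PI) l.
Proof.
  intros Ha Hab Hd Hk Hk' Hk0 Hcl HF Hl.
  (* A derivative is chosen at every point; its values matter only where one exists. *)
  set (F' := fun z => epsilon (inhabits (RtoC 0)) (strict_derive F z)).
  assert (HF' : forall s t : R, a - delta < s < b + delta ->
     strict_derive F (w + s * k t) (F' (w + s * k t)%C)).
  { intros s t hs; apply epsilon_spec, HF, hs. }
  assert (Hkc : forall t, continuous k t) by (intros t; apply (is_derive_C_continuous _ _ _ (Hk t))).
  destruct (ex_RInt_continuous (V := C_R_CompleteNormedModule)
    (fun t => F (w + b * k t) * (k' t / k t))%C 0 (2 * PI)) as [l' Hl'].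
  { intros t _; apply continuous_Cmult.
    - destruct (HF b t) as [m Hm]; [lra|].
      apply (continuous_strict F (fun t => w + b * k t)%C t m Hm).
      apply (continuous_plus (V := C_R_NormedModule)); [apply continuous_const|].
      apply continuous_Cmult; [apply continuous_const | apply Hkc].
    - apply continuous_Cmult; [apply Hk' | apply continuous_Cinv; [apply Hk0 | apply Hkc]]. }
  replace l with l'; [exact Hl'|].
  destruct (is_RInt_C_components _ _ _ _ Hl) as [R1 I1].
  destruct (is_RInt_C_components _ _ _ _ Hl') as [R2 I2].
  apply injective_projections.
  - refine (eq_trans (eq_sym R2) (eq_trans (eq_sym _) R1)).
    exact (radial_invariance_linear Re F F' w k k' a b delta is_linear_Re Ha Hab Hd Hk Hk' Hk0 Hcl HF').
  - refine (eq_trans (eq_sym I2) (eq_trans (eq_sym _) I1)).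
    exact (radial_invariance_linear Im F F' w k k' a b delta is_linear_Im Ha Hab Hd Hk Hk' Hk0 Hcl HF').
Qed.

(** * The unit circle and Cauchy's formula *)

Definition cis (t : R) : C := (cos t, sin t).

Lemma Cexp_cis (t : R) : Cexp (Ci * RtoC t)%C = cis t.
Proof.
  unfold Cexp, cis, Ci, RtoC; cbn.
  replace (0 * t - 1 * 0) with 0 by ring; replace (0 * 0 + 1 * t) with t by ring.
  rewrite exp_0, !Rmult_1_l; reflexivity.
Qed.

Lemma Cmod_cis (t : R) : Cmod (cis t) = 1.
Proof.
  unfold Cmod, cis; cbn [fst snd].
  replace (cos t ^ 2 + sin t ^ 2) with 1; [apply sqrt_1|].
  assert (H := sin2_cos2 t); unfold Rsqr in H; lra.
Qed.

Lemma cis_neq_0 (t : R) : cis t <> RtoC 0.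
Proof. apply Cmod_gt_0; rewrite Cmod_cis; lra. Qed.

Lemma cis_plus (a b : R) : cis (a + b) = (cis a * cis b)%C.
Proof.
  unfold cis; rewrite cos_plus, sin_plus; apply injective_projections; cbn; ring.
Qed.

Lemma cis_0 : cis 0 = RtoC 1.
Proof. unfold cis; rewrite cos_0, sin_0; reflexivity. Qed.

Lemma cis_2PI : cis (2 * PI) = RtoC 1.
Proof. unfold cis; rewrite cos_2PI, sin_2PI; reflexivity. Qed.

Lemma cis_pow (t : R) (n : nat) : cis (t * INR n) = (cis t ^ n)%C.
Proof.
  induction n as [|n IH].
  - rewrite Rmult_0_r; apply cis_0.
  - rewrite S_INR, Rmult_plus_distr_l, Rmult_1_r, cis_plus, IH; cbn; ring.
Qed.

Lemma is_derive_cis (t : R) : is_derive_C cis t (Ci * cis t)%C.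
Proof.
  replace (Ci * cis t)%C with ((- sin t, cos t) : C).
  - apply is_derive_C_pair; auto_derive; trivial; ring.
  - apply injective_projections; cbn; ring.
Qed.

Lemma continuous_cis (t : R) : continuous cis t.
Proof. apply (is_derive_C_continuous _ _ _ (is_derive_cis t)). Qed.

Lemma is_derive_cis_opp (t : R) : is_derive_C (fun u => cis (- u)) t (- Ci * cis (- t))%C.
Proof.
  replace (- Ci * cis (- t))%C with ((- sin t, - cos t) : C).
  - apply (is_derive_ext (V := C_R_NormedModule) (fun u => (cos u, - sin u))).
    + intros u; unfold cis; rewrite cos_neg, sin_neg; reflexivity.
    + apply is_derive_C_pair; auto_derive; trivial; ring.
  - unfold cis; rewrite cos_neg, sin_neg; apply injective_projections; cbn; ring.
Qed.

Lemma Cmod_circle (r t : R) : 0 <= r -> Cmod (r * cis t) = r.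
Proof. intros Hr; rewrite Cmod_mult, Cmod_cis, Cmod_R, Rabs_pos_eq; lra. Qed.

Lemma circle_minus_neq_0 (r t : R) (w : C) : Cmod w < r -> (r * cis t - w)%C <> RtoC 0.
Proof.
  intros Hw E; assert (Pw := Cmod_ge_0 w).
  assert (E2 : (r * cis t)%C = w).
  { replace (r * cis t)%C with (w + (r * cis t - w))%C by ring; rewrite E; ring. }
  assert (E3 := Cmod_circle r t); rewrite E2 in E3; lra.
Qed.

(** With q = w / r the integrand is i / (1 - q e^{-it}). Apart from the sign this is F(s k) k'/k at
    s = 1, where F(z) = 1 / (1 - q z) and k = e^{-it} runs backwards with k'/k = -i. At s = 0 the
    integrand is constant. *)
Lemma circle_kernel_integral (r : R) (w : C) :
  Cmod w < r ->
  is_RInt_C (fun t => r * cis t * Ci / (r * cis t - w))%C 0 (2 * PI) (RtoC (2 * PI) * Ci)%C.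
Proof.
  intros Hw; assert (Pw := Cmod_ge_0 w).
  assert (Hr0 : RtoC r <> RtoC 0) by (apply RtoC_neq_0; lra).
  set (q := (w / r)%C).
  assert (Hq : Cmod q < 1).
  { unfold q; rewrite Cmod_div, Cmod_R, Rabs_pos_eq by (trivial; lra).
    apply Rmult_lt_reg_r with r; [lra|]; unfold Rdiv.
    rewrite Rmult_assoc, Rinv_l; lra. }
  assert (Pq := Cmod_ge_0 q).
  assert (H1 : forall z : C, Cmod z < 1 -> (1 - z)%C <> RtoC 0).
  { intros z Hz E; assert (K : z = RtoC 1).
    { replace z with (1 - (1 - z))%C by ring; rewrite E; ring. }
    rewrite K, Cmod_1 in Hz; lra. }
  assert (K := radial_invariance (fun z => / (1 + - q * z))%C 0 (fun t => cis (- t))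
    (fun t => - Ci * cis (- t))%C 0 1 (1 - Cmod q) (RtoC (2 * PI) * - Ci)%C).
  apply is_RInt_C_ext with
    (fun t => (- (1)) * (/ (1 + - q * (0 + 1 * cis (- t))) * (- Ci * cis (- t) / cis (- t))))%C.
  - intros t.
    assert (E : (cis t * cis (- t))%C = RtoC 1).
    { rewrite <- cis_plus, Rplus_opp_r; apply cis_0. }
    replace (cis (- t)) with (/ cis t)%C.
    2:{ replace (cis (- t)) with (cis t * cis (- t) / cis t)%C by (field; apply cis_neq_0).
        rewrite E; field; apply cis_neq_0. }
    unfold q; field; repeat split; trivial; try apply cis_neq_0; apply circle_minus_neq_0; lra.
  - replace (RtoC (2 * PI) * Ci)%C with (- (1) * (RtoC (2 * PI) * - Ci))%C by ring.
    apply is_RInt_C_mult, K; clear K.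
    + lra.
    + lra.
    + lra.
    + apply is_derive_cis_opp.
    + intros t; apply continuous_Cmult; [apply continuous_const|].
      apply (is_derive_C_continuous _ _ _ (is_derive_cis_opp t)).
    + intros t; apply cis_neq_0.
    + rewrite Ropp_0, cis_0; unfold cis; rewrite cos_neg, sin_neg, cos_2PI, sin_2PI, Ropp_0; reflexivity.
    + intros s t hs; eexists.
      apply (strict_derive_comp Cinv (fun z => 1 + - q * z)%C).
      * apply strict_derive_plus; [apply strict_derive_const|].
        apply strict_derive_mult; [apply strict_derive_const | apply strict_derive_id].
      * apply strict_derive_inv.
        replace (1 + - q * (0 + s * cis (- t)))%C with (1 - q * (s * cis (- t)))%C by ring.
        apply H1; rewrite !Cmod_mult, Cmod_cis, Cmod_R, Rmult_1_r.
        assert (Rabs s < 2 - Cmod q) by (apply Rabs_def1; lra).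
        (* |q| (2 - |q|) = 1 - (1 - |q|)^2 < 1, which explains the margin 1 - |q|. *)
        apply Rle_lt_trans with (Cmod q * (2 - Cmod q)); [apply Rmult_le_compat_l; lra|].
        assert (0 < (1 - Cmod q) * (1 - Cmod q)) by (apply Rmult_lt_0_compat; lra); lra.
    + apply is_RInt_C_ext with (fun _ => - Ci)%C.
      * intros t; replace (1 + - q * (0 + 0 * cis (- t)))%C with (RtoC 1) by ring.
        field; apply cis_neq_0.
      * apply is_RInt_C_const.
Qed.

Definition holomorphic_on_disc (U : C -> C) (rho : R) : Prop :=
  forall z : C, Cmod z < rho -> exists l, strict_derive U z l.

(** The closed curve is z - w, so s running from 1 to 0 contracts the circle onto w. There U is the
    constant U(w) and only the kernel integral remains. *)
Lemma cauchy_formula (U : C -> C) (rho r : R) (w : C) :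
  holomorphic_on_disc U rho -> Cmod w < r -> r < rho ->
  is_RInt_C (fun t => U (r * cis t) * (r * cis t * Ci / (r * cis t - w)))%C 0 (2 * PI)
    (RtoC (2 * PI) * Ci * U w)%C.
Proof.
  intros HU Hw Hr; assert (Pw := Cmod_ge_0 w).
  assert (Hne : forall t, (r * cis t - w)%C <> RtoC 0).
  { intros t; apply circle_minus_neq_0, Hw. }
  apply is_RInt_C_ext with
    (fun t => U (w + 1 * (r * cis t - w)) * (r * (Ci * cis t) / (r * cis t - w)))%C.
  { intros t; replace (w + 1 * (r * cis t - w))%C with (r * cis t)%C by ring.
    f_equal; field; apply Hne. }
  (* For z on the circle, |(1 - s) w + s z| <= (|1 - s| + |s|) r. With the margin d = (rho - r) / (2
     r) the bracket stays below 1 + 2 d, and r (1 + 2 d) = rho. *)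
  apply (radial_invariance U w (fun t => r * cis t - w)%C (fun t => r * (Ci * cis t))%C
    0 1 ((rho - r) / (2 * r))).
  - lra.
  - lra.
  - apply Rdiv_lt_0_compat; lra.
  - intros t; apply (is_derive_ext (V := C_R_NormedModule) (fun u => - w + r * cis u)%C).
    + intros u; apply Cplus_comm.
    + apply is_derive_C_shift, is_derive_C_mult, is_derive_cis.
  - intros t; repeat (apply continuous_Cmult; [apply continuous_const|]); apply continuous_cis.
  - exact Hne.
  - rewrite cis_2PI, cis_0; reflexivity.
  - intros s t hs; apply HU.
    replace (w + s * (r * cis t - w))%C with ((1 - s)%R * w + s * (r * cis t))%C
      by (rewrite RtoC_minus; ring).
    eapply Rle_lt_trans; [apply Cmod_triangle|].
    rewrite !Cmod_mult, Cmod_cis, !Cmod_R, (Rabs_pos_eq r), Rmult_1_r by lra.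
    set (d := (rho - r) / (2 * r)) in *.
    assert (Hd : r * (1 + 2 * d) = rho) by (unfold d; field; lra).
    assert (0 < d) by (unfold d; apply Rdiv_lt_0_compat; lra).
    assert (Hs : Rabs (1 - s) + Rabs s < 1 + 2 * d).
    { unfold Rabs; destruct (Rcase_abs (1 - s)), (Rcase_abs s); lra. }
    apply Rle_lt_trans with ((Rabs (1 - s) + Rabs s) * r).
    + rewrite Rmult_plus_distr_r; apply Rplus_le_compat_r, Rmult_le_compat_l; [apply Rabs_pos | lra].
    + rewrite <- Hd, Rmult_comm; apply Rmult_lt_compat_l; lra.
  - apply is_RInt_C_ext with
      (fun t => U w * (r * cis t * Ci / (r * cis t - w)))%C.
    + intros t; replace (w + 0 * (r * cis t - w))%C with w by ring.
      f_equal; field; apply Hne.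
    + rewrite (Cmult_comm _ (U w)); apply is_RInt_C_mult, circle_kernel_integral, Hw.
Qed.

(** Here w = 0 and k is the unit circle, so s is the radius itself and k'/k = i. Since dz = i z dt,
    the integrand U(z) z^{-n-1} dz appears with exponent n only. *)
Lemma contour_radius_invariance (U : C -> C) (rho lambda r : R) (n : nat) (l : C) :
  holomorphic_on_disc U rho -> 0 < lambda -> lambda < r -> r < rho ->
  is_RInt_C (fun t => U (lambda * cis t) / (lambda * cis t) ^ n * Ci)%C 0 (2 * PI) l ->
  is_RInt_C (fun t => U (r * cis t) / (r * cis t) ^ n * Ci)%C 0 (2 * PI) l.
Proof.
  intros HU Hl Hlr Hr Hint.
  assert (Hne : forall s t : R, 0 < s -> (s * cis t)%C <> RtoC 0).
  { intros s t Hs; apply Cmod_gt_0; rewrite Cmod_circle; lra. }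
  assert (E : forall s : R, 0 < s -> forall t,
    (U (s * cis t) / (s * cis t) ^ n * Ci =
     U (0 + s * cis t) * (/ (0 + s * cis t)) ^ n * (Ci * cis t / cis t))%C).
  { intros s Hs t; replace (0 + s * cis t)%C with (s * cis t)%C by ring.
    rewrite Cpow_inv by (apply Hne, Hs).
    field; split; [apply cis_neq_0 | apply Cpow_nz, Hne, Hs]. }
  apply is_RInt_C_ext with (1 := fun t => eq_sym (E r ltac:(lra) t)).
  apply is_RInt_C_ext with (1 := fun t => E lambda Hl t) in Hint.
  (* This margin keeps the radii in (0, rho), away from the singularity of z^{-n} at 0 and inside
     the disc of holomorphy. *)
  set (m := Rmin lambda (rho - r)).
  assert (m1 : m <= lambda) by apply Rmin_l; assert (m2 : m <= rho - r) by apply Rmin_r.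
  apply (radial_invariance (fun z => U z * (/ z) ^ n)%C 0 cis (fun t => Ci * cis t)%C
    lambda r m).
  - lra.
  - lra.
  - apply Rmin_glb_lt; lra.
  - apply is_derive_cis.
  - intros t; apply continuous_Cmult; [apply continuous_const | apply continuous_cis].
  - apply cis_neq_0.
  - rewrite cis_2PI, cis_0; reflexivity.
  - intros s t hs; replace (0 + s * cis t)%C with (s * cis t)%C by ring.
    destruct (HU (s * cis t)%C) as [l1 H1]; [rewrite Cmod_circle; lra|].
    destruct (strict_derive_pow Cinv _ _ n (strict_derive_inv (s * cis t)%C (Hne s t ltac:(lra))))
      as [l2 H2].
    eexists; apply (strict_derive_mult _ _ _ _ _ H1 H2).
  - exact Hint.
Qed.

(** * The trapezoidal rule *)

Lemma Csum_S (f : nat -> C) (m n : nat) :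
  (m <= S n)%nat -> Csum f m (S n) = (Csum f m n + f (S n))%C.
Proof. apply (sum_n_Sm (G := C_AbelianMonoid)). Qed.

Lemma Csum_n_n (f : nat -> C) (n : nat) : Csum f n n = f n.
Proof. apply (sum_n_n (G := C_AbelianMonoid)). Qed.

Lemma Csum_1_0 (f : nat -> C) : Csum f 1 0 = RtoC 0.
Proof. apply (sum_n_m_zero (G := C_AbelianMonoid)); lia. Qed.

Lemma Csum_ext_loc (f g : nat -> C) (m n : nat) :
  (forall k, (m <= k <= n)%nat -> f k = g k) -> Csum f m n = Csum g m n.
Proof. apply (sum_n_m_ext_loc (G := C_AbelianMonoid)). Qed.

Lemma Csum_mult_l (c : C) (f : nat -> C) (m n : nat) :
  Csum (fun k => c * f k)%C m n = (c * Csum f m n)%C.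
Proof. apply (sum_n_m_mult_l (K := C_Ring)). Qed.

Lemma Csum_plus (f g : nat -> C) (m n : nat) :
  Csum (fun k => f k + g k)%C m n = (Csum f m n + Csum g m n)%C.
Proof. apply (sum_n_m_plus (G := C_AbelianMonoid)). Qed.

Lemma Csum_const_zero (m n : nat) : Csum (fun _ => RtoC 0) m n = RtoC 0.
Proof. apply (sum_n_m_const_zero (G := C_AbelianMonoid)). Qed.

Lemma Csum_switch (f : nat -> nat -> C) (N J : nat) :
  Csum (fun k => Csum (f k) 0 J) 1 N = Csum (fun j => Csum (fun k => f k j) 1 N) 0 J.
Proof.
  induction N as [|N IH].
  - rewrite Csum_1_0; symmetry.
    rewrite (Csum_ext_loc _ (fun _ => RtoC 0)); [apply Csum_const_zero|].
    intros j _; apply Csum_1_0.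
  - rewrite Csum_S, IH, <- Csum_plus by lia; apply Csum_ext_loc; intros j _.
    rewrite Csum_S by lia; reflexivity.
Qed.

Lemma Csum_single (f : nat -> C) (n J : nat) :
  (n <= J)%nat -> (forall j, (j <= J)%nat -> j <> n -> f j = RtoC 0) -> Csum f 0 J = f n.
Proof.
  intros Hn Hf; induction J as [|J IH].
  - replace n with 0%nat by lia; apply Csum_n_n.
  - rewrite Csum_S by lia; destruct (Nat.eq_dec n (S J)) as [E|E].
    + rewrite (Csum_ext_loc f (fun _ => RtoC 0)).
      * rewrite Csum_const_zero, E; ring.
      * intros j Hj; apply Hf; lia.
    + rewrite IH, (Hf (S J)); [ring | lia | lia | lia | intros j Hj; apply Hf; lia].
Qed.

Lemma is_RInt_C_sum (f : nat -> R -> C) (l : nat -> C) (a b : R) (N : nat) :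
  (forall k, is_RInt_C (f k) a b (l k)) ->
  is_RInt_C (fun t => Csum (fun k => f k t) 1 N) a b (Csum l 1 N).
Proof.
  intros H; induction N as [|N IH].
  - rewrite Csum_1_0.
    apply is_RInt_C_ext with (fun t => 0 * f 0%nat t)%C.
    + intros t; rewrite Csum_1_0; ring.
    + assert (K := is_RInt_C_mult 0 _ _ _ _ (H 0%nat)); rewrite Cmult_0_l in K; exact K.
  - rewrite Csum_S by lia.
    apply is_RInt_C_ext with (fun t => Csum (fun k => f k t) 1 N + f (S N) t)%C.
    + intros t; rewrite Csum_S by lia; reflexivity.
    + apply (is_RInt_plus (V := C_R_NormedModule)); [exact IH | apply H].
Qed.

Lemma is_RInt_C_minus (f g : R -> C) (a b : R) (l m : C) :
  is_RInt_C f a b l -> is_RInt_C g a b m -> is_RInt_C (fun t => f t - g t)%C a b (l - m)%C.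
Proof. exact (is_RInt_minus (V := C_R_NormedModule) f g a b l m). Qed.

Lemma is_RInt_C_bound (f : R -> C) (b M : R) (l : C) :
  0 <= b -> is_RInt_C f 0 b l -> (forall t, 0 <= t <= b -> Cmod (f t) <= M) -> Cmod l <= b * M.
Proof.
  intros Hb Hl Hf; rewrite Cmod_norm; replace (b * M) with ((b - 0) * M) by ring.
  apply (norm_RInt_le_const (V := C_R_NormedModule) f 0 b l M Hb); [|exact Hl].
  intros t Ht; rewrite <- Cmod_norm; apply Hf, Ht.
Qed.

(** * Geometric sums, roots of unity and the quadrature kernel *)

Lemma Cpow_minus_geometric (z w : C) (N : nat) :
  ((z - w) * Csum (fun j => z ^ (N - j) * w ^ j) 0 N = z ^ S N - w ^ S N)%C.
Proof.
  induction N as [|N IH].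
  - rewrite Csum_n_n; cbn; ring.
  - rewrite Csum_S by lia.
    rewrite (Csum_ext_loc _ (fun j => z * (z ^ (N - j) * w ^ j))%C).
    + rewrite Csum_mult_l, Nat.sub_diag.
      replace ((z - w) * (z * Csum (fun j => z ^ (N - j) * w ^ j) 0 N + z ^ 0 * w ^ S N))%C
        with (z * ((z - w) * Csum (fun j => z ^ (N - j) * w ^ j) 0 N) + (z - w) * w ^ S N)%C
        by (cbn; ring).
      rewrite IH; cbn; ring.
    + intros j Hj; replace (S N - j)%nat with (S (N - j)) by lia; cbn; ring.
Qed.

Lemma pow_lt_l (a b : R) (n : nat) : 0 <= a < b -> (1 <= n)%nat -> a ^ n < b ^ n.
Proof.
  intros Hab Hn; replace (a ^ n) with ((a / b) ^ n * b ^ n).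
  - assert (Hb : 0 < b ^ n) by (apply pow_lt; lra).
    rewrite <- (Rmult_1_l (b ^ n)) at 2; apply Rmult_lt_compat_r; [exact Hb|].
    apply pow_lt_1_compat; [|lia]; split.
    + apply Rmult_le_pos; [lra | left; apply Rinv_0_lt_compat; lra].
    + apply Rmult_lt_reg_r with b; [lra|]; unfold Rdiv; rewrite Rmult_assoc, Rinv_l; lra.
  - rewrite <- Rpow_mult_distr; f_equal; field; lra.
Qed.

(** Equal values give cos (a - b) = 1, that is sin ((a - b) / 2) = 0, and the half difference lies
    in (-pi, pi), where the sine vanishes only at 0. *)
Lemma cis_injective (a b : R) : Rabs (a - b) < 2 * PI -> cis a = cis b -> a = b.
Proof.
  intros Hab E; assert (HP := PI_RGT_0).
  injection E as Ec Es.
  assert (C1 : cos (a - b) = 1).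
  { rewrite cos_minus, Ec, Es; assert (H := sin2_cos2 b); unfold Rsqr in H; lra. }
  assert (S0 : sin ((a - b) / 2) = 0).
  { replace (a - b) with (2 * ((a - b) / 2)) in C1 by field.
    rewrite cos_2a_sin in C1; apply Rsqr_0_uniq; unfold Rsqr; lra. }
  apply Rabs_def2 in Hab.
  destruct (Rtotal_order a b) as [L|[L|L]]; [|exact L|].
  - assert (0 < sin (- ((a - b) / 2))) by (apply sin_gt_0; lra).
    rewrite sin_neg in *; lra.
  - assert (0 < sin ((a - b) / 2)) by (apply sin_gt_0; lra); lra.
Qed.

Lemma root_of_unity_sum (q : C) (N : nat) :
  (q ^ N)%C = RtoC 1 -> q <> RtoC 1 -> Csum (fun k => q ^ k)%C 1 N = RtoC 0.
Proof.
  intros H1 Hq.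
  assert (E : ((q - 1) * Csum (fun k => q ^ k) 1 N = q * (q ^ N - 1))%C).
  { clear H1; induction N as [|N IH].
    - rewrite Csum_1_0; cbn; ring.
    - rewrite Csum_S by lia.
      rewrite Cmult_plus_distr_l, IH; cbn; ring. }
  assert (Hq' : (q - 1)%C <> RtoC 0).
  { intros K; apply Hq; replace q with (q - 1 + 1)%C by ring; rewrite K; ring. }
  replace (Csum (fun k => q ^ k)%C 1 N) with (((q - 1) * Csum (fun k => q ^ k) 1 N) / (q - 1))%C
    by (field; exact Hq').
  rewrite E, H1; field; exact Hq'.
Qed.

Lemma node_cis (lambda : R) (N k : nat) :
  node lambda N k = (lambda * cis (2 * PI / INR N) ^ k)%C.
Proof.
  unfold node; rewrite Cexp_cis, <- cis_pow; do 2 f_equal; unfold Rdiv; ring.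
Qed.

Lemma Cmod_node (lambda : R) (N k : nat) : 0 <= lambda -> Cmod (node lambda N k) = lambda.
Proof. intros H; unfold node; rewrite Cexp_cis; apply Cmod_circle, H. Qed.

Lemma root_of_unity_pow (N : nat) : (1 <= N)%nat -> (cis (2 * PI / INR N) ^ N)%C = RtoC 1.
Proof.
  intros HN; rewrite <- cis_pow.
  replace (2 * PI / INR N * INR N) with (2 * PI) by (field; apply not_0_INR; lia).
  apply cis_2PI.
Qed.

Lemma node_pow (lambda : R) (N k : nat) :
  (1 <= N)%nat -> (node lambda N k ^ N)%C = (RtoC lambda ^ N)%C.
Proof.
  intros HN; rewrite node_cis, Cpow_mult_l, <- Cpow_mult_r, Nat.mul_comm, Cpow_mult_r,
    root_of_unity_pow, Cpow_1_l by exact HN; ring.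
Qed.

(** Discrete orthogonality: with omega = e^{2 pi i / N} the terms are lambda^{j-n} q^k for q =
    omega^{j-n}, an N-th root of unity. Since |j - n| < N, it equals 1 only for j = n; larger
    exponents would alias. *)
Lemma node_power_sum (lambda : R) (N n j : nat) :
  0 < lambda -> (n < N)%nat -> (j < N)%nat ->
  Csum (fun k => node lambda N k ^ j / node lambda N k ^ n)%C 1 N =
  if Nat.eq_dec j n then RtoC (INR N) else RtoC 0.
Proof.
  intros Hl Hn Hj.
  assert (Hl0 : RtoC lambda <> RtoC 0) by (apply RtoC_neq_0; lra).
  set (om := cis (2 * PI / INR N)).
  assert (Hom : om <> RtoC 0) by apply cis_neq_0.
  assert (HN : 0 < INR N) by (apply lt_0_INR; lia).
  assert (HP := PI_RGT_0).
  set (q := (om ^ j / om ^ n)%C).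
  rewrite (Csum_ext_loc _ (fun k => (lambda ^ j / lambda ^ n) * q ^ k)%C).
  2:{ intros k _; rewrite node_cis; fold om; unfold q, Cdiv.
      rewrite !Cpow_mult_l, !Cpow_inv by (apply Cpow_nz; assumption).
      rewrite <- !Cpow_mult_r, (Nat.mul_comm k j), (Nat.mul_comm k n).
      field; split; apply Cpow_nz; assumption. }
  rewrite Csum_mult_l; destruct (Nat.eq_dec j n) as [E|E].
  - subst j; replace q with (RtoC 1) by (unfold q; field; apply Cpow_nz, Hom).
    replace (lambda ^ n / lambda ^ n)%C with (RtoC 1) by (field; apply Cpow_nz, Hl0).
    rewrite Cmult_1_l; clear.
    induction N as [|N IH]; [apply Csum_1_0|].
    rewrite Csum_S, IH, Cpow_1_l, S_INR, RtoC_plus by lia; reflexivity.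
  - rewrite root_of_unity_sum; [ring| |].
    + unfold q, Cdiv; rewrite Cpow_mult_l, Cpow_inv by (apply Cpow_nz, Hom).
      rewrite <- !Cpow_mult_r, (Nat.mul_comm j), (Nat.mul_comm n), !Cpow_mult_r.
      unfold om; rewrite root_of_unity_pow, !Cpow_1_l by lia; field.
    + intros Hq; apply E.
      assert (K : (om ^ j = om ^ n)%C).
      { replace (om ^ j)%C with (q * om ^ n)%C by (unfold q; field; apply Cpow_nz, Hom).
        rewrite Hq; ring. }
      unfold om in K; rewrite <- !cis_pow in K.
      apply cis_injective in K.
      * apply INR_eq, Rmult_eq_reg_l with (1 := K), Rgt_not_eq, Rdiv_lt_0_compat; lra.
      * replace (2 * PI / INR N * INR j - 2 * PI / INR N * INR n) with
          (2 * PI * ((INR j - INR n) / INR N)) by (field; lra).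
        rewrite Rabs_mult, (Rabs_pos_eq (2 * PI)) by lra.
        rewrite <- (Rmult_1_r (2 * PI)) at 2; apply Rmult_lt_compat_l; [lra|].
        unfold Rdiv; rewrite Rabs_mult, (Rabs_pos_eq (/ INR N))
          by (left; apply Rinv_0_lt_compat, HN).
        apply Rmult_lt_reg_r with (INR N); [exact HN|].
        rewrite Rmult_assoc, Rinv_l, Rmult_1_r, Rmult_1_l by lra.
        assert (INR j < INR N) by (apply lt_INR, Hj); assert (INR n < INR N) by (apply lt_INR, Hn).
        assert (P1 := pos_INR j); assert (P2 := pos_INR n).
        apply Rabs_def1; lra.
Qed.

(* Partial fractions over the N-th roots of lambda^N. *)
Lemma quadrature_kernel (lambda : R) (N n : nat) (z : C) :
  0 < lambda -> (n < N)%nat -> lambda < Cmod z ->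
  Csum (fun k => / node lambda N k ^ n * (z * Ci / (z - node lambda N k)))%C 1 N =
  (INR N * (z ^ (N - n) * Ci / (z ^ N - lambda ^ N)))%C.
Proof.
  intros Hl Hn Hz.
  assert (Hne : (z ^ N - lambda ^ N)%C <> RtoC 0).
  { intros E; assert (K : Cmod (z ^ N) = Cmod (RtoC lambda ^ N)).
    { f_equal; replace (z ^ N)%C with (z ^ N - lambda ^ N + lambda ^ N)%C by ring; rewrite E; ring. }
    rewrite !Cmod_pow, Cmod_R, Rabs_pos_eq in K by lra.
    assert (L : lambda ^ N < Cmod z ^ N) by (apply pow_lt_l; [lra | lia]); lra. }
  assert (Hw : forall k, (z - node lambda N k)%C <> RtoC 0).
  { intros k E; assert (K : z = node lambda N k).
    { replace z with (z - node lambda N k + node lambda N k)%C by ring; rewrite E; ring. }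
    rewrite K, Cmod_node in Hz; lra. }
  destruct N as [|N]; [lia|].
  (* Every node w satisfies w^{N+1} = lambda^{N+1}, N + 1 being the number of nodes from here on.
     Hence 1 / (z - w) is the geometric sum of z^{N-j} w^j over a denominator common to all nodes,
     and orthogonality leaves only j = n. *)
  rewrite (Csum_ext_loc _ (fun k => (z * Ci / (z ^ S N - lambda ^ S N)) *
    Csum (fun j => z ^ (N - j) * (node lambda (S N) k ^ j / node lambda (S N) k ^ n)) 0 N)%C).
  - rewrite Csum_mult_l, Csum_switch, (Csum_single _ n N).
    + rewrite Csum_mult_l, node_power_sum by (lia || lra).
      destruct (Nat.eq_dec n n) as [_|]; [|congruence].
      replace (S N - n)%nat with (S (N - n)) by lia; rewrite (Cpow_S z (N - n)).
      unfold Cdiv; ring.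
    + lia.
    + intros j Hj Hjn; rewrite Csum_mult_l, node_power_sum by (lia || lra).
      destruct (Nat.eq_dec j n) as [|_]; [congruence | ring].
  - intros k _; set (w := node lambda (S N) k).
    assert (Hw0 : (w ^ n)%C <> RtoC 0).
    { apply Cpow_nz, Cmod_gt_0; unfold w; rewrite Cmod_node; lra. }
    assert (G := Cpow_minus_geometric z w N).
    unfold w in G at 3; rewrite node_pow in G by lia; fold w in G.
    rewrite (Csum_ext_loc _ (fun j => / w ^ n * (z ^ (N - j) * w ^ j))%C)
      by (intros j _; unfold Cdiv; ring).
    rewrite Csum_mult_l, <- G; assert (Hwk := Hw k); fold w in Hwk.
    rewrite <- G in Hne.
    field; repeat split; try assumption.
    intros E; apply Hne; rewrite E; ring.
Qed.

(** Because dz = i z dt, the powers z^{N-1-n} and z^{-n-1} of the contour integrals become z^{N-n}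
    and z^{-n} under the parameter integral. *)
Lemma quadrature_error_integral (U : C -> C) (rho lambda r : R) (N n : nat) :
  holomorphic_on_disc U rho -> 0 < lambda -> lambda < r -> r < rho -> (n < N)%nat ->
  is_RInt_C (fun t => U (r * cis t) * Ci *
      ((r * cis t) ^ (N - n) / ((r * cis t) ^ N - lambda ^ N) - / (r * cis t) ^ n))%C 0 (2 * PI)
    (RtoC (2 * PI) * Ci * (u_quadrature U lambda N n - u_contour U lambda n))%C.
Proof.
  intros HU Hl Hlr Hr Hn.
  assert (HP := PI_RGT_0).
  assert (HN : RtoC (INR N) <> RtoC 0) by (apply RtoC_neq_0, not_0_INR; lia).
  assert (HPC : (RtoC (2 * PI) * Ci)%C <> RtoC 0).
  { apply Cmult_neq_0; [apply RtoC_neq_0; lra | intros E; injection E; lra]. }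
  assert (Hne : forall t, (r * cis t)%C <> RtoC 0).
  { intros t; apply Cmod_gt_0; rewrite Cmod_circle; lra. }
  assert (Q : is_RInt_C (fun t => U (r * cis t) * Ci *
      ((r * cis t) ^ (N - n) / ((r * cis t) ^ N - lambda ^ N)))%C 0 (2 * PI)
      (RtoC (2 * PI) * Ci * u_quadrature U lambda N n)%C).
  { unfold u_quadrature.
    replace (RtoC (2 * PI) * Ci * (/ INR N * Csum (fun k => U (node lambda N k) / node lambda N k ^ n) 1 N))%C
      with (/ INR N * Csum (fun k => / node lambda N k ^ n * (RtoC (2 * PI) * Ci * U (node lambda N k))) 1 N)%C.
    - apply is_RInt_C_ext with (fun t => / INR N * Csum (fun k => / node lambda N k ^ n *
        (U (r * cis t) * (r * cis t * Ci / (r * cis t - node lambda N k)))) 1 N)%C.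
      + intros t.
        rewrite (Csum_ext_loc _ (fun k => U (r * cis t) * (/ node lambda N k ^ n *
          (r * cis t * Ci / (r * cis t - node lambda N k))))%C) by (intros k _; ring).
        rewrite Csum_mult_l, quadrature_kernel; [|exact Hl|exact Hn|rewrite Cmod_circle; lra].
        unfold Cdiv; set (i := (/ ((r * cis t) ^ N - lambda ^ N))%C); field; exact HN.
      + apply is_RInt_C_mult, is_RInt_C_sum with
          (f := fun k t => (/ node lambda N k ^ n *
             (U (r * cis t) * (r * cis t * Ci / (r * cis t - node lambda N k))))%C).
        intros k; apply is_RInt_C_mult, cauchy_formula with rho; [exact HU | | exact Hr].
        rewrite Cmod_node; lra.
    - rewrite (Csum_ext_loc _ (fun k => (RtoC (2 * PI) * Ci) * (U (node lambda N k) / node lambda N k ^ n))%C)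
        by (intros k _; unfold Cdiv; ring).
      rewrite Csum_mult_l; ring. }
  assert (K : is_RInt_C (fun t => U (r * cis t) / (r * cis t) ^ n * Ci)%C 0 (2 * PI)
      (RtoC (2 * PI) * Ci * u_contour U lambda n)%C).
  { apply contour_radius_invariance with rho lambda; trivial.
    unfold u_contour; set (p := (RtoC (2 * PI) * Ci)%C) in *.
    replace (p * (/ p * circle_integral (fun z => U z / z ^ S n) lambda))%C with
      (circle_integral (fun z => U z / z ^ S n)%C lambda) by (field; exact HPC).
    assert (Hne' : forall t, (lambda * cis t)%C <> RtoC 0).
    { intros t; apply Cmod_gt_0; rewrite Cmod_circle; lra. }
    (* The factor i z coming from dz removes one power of z^{n+1}. *)
    assert (E : forall t, (U (lambda * cis t) / (lambda * cis t) ^ n * Ci =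
      U (lambda * Cexp (Ci * t)) / (lambda * Cexp (Ci * t)) ^ S n * (Ci * (lambda * Cexp (Ci * t))))%C).
    { intros t; rewrite Cexp_cis, Cpow_S.
      assert (H1 := Hne' t); set (w := (lambda * cis t)%C) in *.
      field; split; [apply Cpow_nz|]; exact H1. }
    apply is_RInt_C_ext with (1 := fun t => eq_sym (E t)).
    apply (RInt_correct (V := C_R_CompleteNormedModule)),
      (ex_RInt_continuous (V := C_R_CompleteNormedModule)); intros t _.
    apply (continuous_ext (T := R_UniformSpace) (U := C_UniformSpace) _ _ _ E).
    assert (Hc : continuous (fun t => lambda * cis t)%C t)
      by (apply continuous_Cmult; [apply continuous_const | apply continuous_cis]).
    destruct (HU (lambda * cis t)%C) as [l HUl]; [rewrite Cmod_circle; lra|].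
    destruct (strict_derive_pow _ _ _ n (strict_derive_id (lambda * cis t)%C)) as [m Hm].
    apply continuous_Cmult; [apply continuous_Cmult | apply continuous_const].
    - apply (continuous_strict U _ t l HUl Hc).
    - apply continuous_Cinv; [apply Cpow_nz, Hne'|].
      apply (continuous_strict (fun z => z ^ n)%C _ t m Hm Hc). }
  replace (RtoC (2 * PI) * Ci * (u_quadrature U lambda N n - u_contour U lambda n))%C with
    (RtoC (2 * PI) * Ci * u_quadrature U lambda N n - RtoC (2 * PI) * Ci * u_contour U lambda n)%C
    by ring.
  eapply is_RInt_C_ext; [|exact (is_RInt_C_minus _ _ _ _ _ _ Q K)].
  intros t; unfold Cdiv; ring.
Qed.

Lemma trapezoid_error (U : C -> C) (rho lambda r : R) (n : nat) :
  holomorphic_on_disc U rho -> 0 < lambda -> lambda < r -> r < rho ->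
  exists M, 0 <= M /\ forall N, (n < N)%nat ->
    Cmod (u_quadrature U lambda N n - u_contour U lambda n) <= M * (lambda / r) ^ N.
Proof.
  intros HU Hl Hlr Hr; assert (HP := PI_RGT_0).
  destruct (continuity_ab_maj (fun t => Cmod (U (r * cis t)%C)) 0 (2 * PI)) as [t0 [Hmax _]]; [lra| |].
  { intros t _; apply continuity_pt_filterlim.
    apply (continuous_comp (V := C_UniformSpace) (fun t => U (r * cis t)%C) Cmod).
    - destruct (HU (r * cis t)%C) as [l HUl]; [rewrite Cmod_circle; lra|].
      apply (continuous_strict U (fun t => r * cis t)%C t l HUl).
      apply continuous_Cmult; [apply continuous_const | apply continuous_cis].
    - apply (continuous_ext (T := C_UniformSpace) (U := R_UniformSpace) (fun z : C_R_NormedModule => norm z)).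
      + intros z; symmetry; apply Cmod_norm.
      + apply (filterlim_norm (V := C_R_NormedModule)). }
  set (A := Cmod (U (r * cis t0)%C)) in *; assert (HA : 0 <= A) by apply Cmod_ge_0.
  set (q := lambda / r).
  assert (Hq : 0 < q < 1).
  { split; [apply Rdiv_lt_0_compat; lra|].
    apply Rmult_lt_reg_r with r; [lra|]; unfold q, Rdiv; rewrite Rmult_assoc, Rinv_l; lra. }
  assert (Hrn : 0 < r ^ n) by (apply pow_lt; lra).
  (* A is the maximum of |U| on |z| = r. For N >= 1, |z^N - lambda^N| >= r^N (1 - q^N) >= r^N (1 -
     q), which makes the constant independent of N. *)
  exists (A * (/ r ^ n / (1 - q))); split.
  { repeat apply Rmult_le_pos; [exact HA | left | left]; apply Rinv_0_lt_compat; lra. }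
  intros N HN.
  assert (HqN : q ^ N <= q).
  { destruct N as [|N]; [lia|]; cbn.
    rewrite <- (Rmult_1_r q) at 3; apply Rmult_le_compat_l; [lra|].
    rewrite <- (pow1 N); apply pow_incr; lra. }
  assert (HrN : 0 < r ^ N) by (apply pow_lt; lra).
  assert (HlN : lambda ^ N = q ^ N * r ^ N).
  { unfold q; rewrite <- Rpow_mult_distr; f_equal; field; lra. }
  assert (HqN0 : 0 < q ^ N) by (apply pow_lt; lra).
  apply Rmult_le_reg_l with (2 * PI); [lra|].
  assert (E : 2 * PI = Cmod (RtoC (2 * PI) * Ci)).
  { rewrite Cmod_mult, Cmod_Ci, Cmod_R, Rabs_pos_eq; lra. }
  rewrite E at 1; rewrite <- Cmod_mult.
  apply (is_RInt_C_bound _ (2 * PI) _ _ ltac:(lra)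
    (quadrature_error_integral U rho lambda r N n HU Hl Hlr Hr HN)).
  intros t Ht; clear E.
  set (z := (r * cis t)%C).
  assert (Hz : Cmod z = r) by (apply Cmod_circle; lra).
  assert (Hz0 : z <> RtoC 0) by (apply Cmod_gt_0; lra).
  assert (HzN : r ^ N * (1 - q) <= Cmod (z ^ N - lambda ^ N)).
  { assert (T := Cmod_le_plus (z ^ N) (lambda ^ N)).
    rewrite !Cmod_pow, Hz, Cmod_R, Rabs_pos_eq, HlN in T by lra.
    assert (q ^ N * r ^ N <= q * r ^ N) by (apply Rmult_le_compat_r; lra); lra. }
  assert (HD : 0 < r ^ N * (1 - q)) by (apply Rmult_lt_0_compat; lra).
  assert (Hne : (z ^ N - lambda ^ N)%C <> RtoC 0) by (apply Cmod_gt_0; lra).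
  (* The difference of the two kernels carries the factor lambda^N; against z^N in the denominator
     this is the whole convergence rate. *)
  replace (z ^ (N - n) / (z ^ N - lambda ^ N) - / z ^ n)%C with
    (lambda ^ N * / z ^ n * / (z ^ N - lambda ^ N))%C.
  2:{ replace (z ^ N)%C with (z ^ (N - n) * z ^ n)%C in * by (rewrite <- Cpow_add_r; f_equal; lia).
      field; split; [apply Cpow_nz, Hz0 | exact Hne]. }
  rewrite !Cmod_mult, !Cmod_inv, !Cmod_pow, Cmod_Ci, Cmod_R, Hz, (Rabs_pos_eq lambda), Rmult_1_r
    by (try apply Cpow_nz; trivial; lra).
  rewrite !Rmult_assoc; apply Rmult_le_compat; [apply Cmod_ge_0 | | apply Hmax, Ht |].
  - repeat apply Rmult_le_pos; left; try apply pow_lt; try apply Rinv_0_lt_compat; lra.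
  - apply Rle_trans with (lambda ^ N * (/ r ^ n * / (r ^ N * (1 - q)))).
    + repeat apply Rmult_le_compat_l; [apply pow_le; lra | left; apply Rinv_0_lt_compat, Hrn|].
      apply Rinv_le_contravar; assumption.
    + right; rewrite HlN; unfold Rdiv; field; lra.
Qed.

(** * Power series of data and operators *)

(** A point off the boundary is interior to Omega or to its complement, and both are open
    conditions. This closedness of the boundary enters the compactness argument below. *)
Lemma boundary_locally_complement (Omega : R3 -> Prop) (y : R3) :
  ~ boundary Omega y -> locally y (fun z => ~ boundary Omega z).
Proof.
  intros H; destruct (classic (locally y Omega)) as [L|L].
  - apply locally_locally in L; revert L; apply filter_imp; intros z Lz [_ K]; exact (K Lz).
  - destruct (classic (locally y (fun z => ~ Omega z))) as [L'|L'].
    + apply locally_locally in L'; revert L'; apply filter_imp; intros z Lz [K _]; exact (K Lz).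
    + destruct H; split; assumption.
Qed.

Lemma coord_le_norm3 (a b c : R) :
  Rabs a <= norm3 (a, b, c) /\ Rabs b <= norm3 (a, b, c) /\ Rabs c <= norm3 (a, b, c).
Proof.
  unfold norm3; cbn [fst snd].
  assert (Ha := pow2_ge_0 a); assert (Hb := pow2_ge_0 b); assert (Hc := pow2_ge_0 c).
  assert (K : forall u s, u ^ 2 <= s -> Rabs u <= sqrt s).
  { intros u s Hs; rewrite <- sqrt_Rsqr_abs; apply sqrt_le_1_alt; unfold Rsqr; lra. }
  repeat split; apply K; lra.
Qed.

Lemma boundary_coord_bounded (Omega : R3 -> Prop) :
  bounded_set Omega -> exists r, forall a b c, boundary Omega (a, b, c) ->
    (- r <= a <= r) /\ (- r <= b <= r) /\ (- r <= c <= r).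
Proof.
  (* The extra 1 allows for the distance, in each coordinate, to a point of Omega in the unit ball
     around the boundary point. *)
  intros [r Hr]; exists (r + 1); intros a b c [Hcl _].
  assert (E : exists z : R3, ball (a, b, c) 1 z /\ Omega z).
  { apply NNPP; intros N; apply Hcl; exists (mkposreal 1 Rlt_0_1); intros z Hz Oz.
    apply N; exists z; split; assumption. }
  destruct E as [[[a' b'] c'] [[[Ba Bb] Bc] Oz]].
  change (Rabs (a' - a) < 1) in Ba; change (Rabs (b' - b) < 1) in Bb; change (Rabs (c' - c) < 1) in Bc.
  destruct (coord_le_norm3 a' b' c') as [Ka [Kb Kc]]; specialize (Hr _ Oz).
  assert (J : forall u v, Rabs (u - v) < 1 -> Rabs u <= r -> - (r + 1) <= v <= r + 1).
  { intros u v H1 H2; apply Rabs_def2 in H1; apply Rabs_le_between in H2; lra. }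
  split; [|split]; [apply (J a') | apply (J b') | apply (J c')]; lra.
Qed.

Lemma continuous_on_C_iff (D : R3 -> Prop) (f : R3 -> C) :
  continuous_on D f <->
  forall x, D x -> forall eps, 0 < eps -> locally x (fun y => D y -> Cmod (f y - f x) < eps).
Proof.
  split; intros H x Dx.
  - intros eps He.
    assert (He' : 0 < eps / sqrt 2) by (apply Rdiv_lt_0_compat; [exact He | apply sqrt_lt_R0; lra]).
    assert (K := proj1 (filterlim_locally f (f x)) (H x Dx) (mkposreal _ He')).
    unfold within in K; revert K; apply filter_imp; intros y Hy Dy; specialize (Hy Dy).
    apply (C_NormedModule_mixin_compat2 (f x) (f y)) in Hy.
    eapply Rlt_le_trans; [exact Hy|]; right; cbn; field; apply Rgt_not_eq, sqrt_lt_R0; lra.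
  - apply filterlim_locally; intros eps; unfold within.
    generalize (H x Dx eps (cond_pos eps)); apply filter_imp; intros y Hy Dy.
    apply (C_NormedModule_mixin_compat1 (f x) (f y) eps (Hy Dy)).
Qed.

(** Compactness of a box is used through gauges: one positive number plays two roles, as a radius
    around y and as the reciprocal of a bound for |f| on that ball. A uniform lower bound d for the
    gauge then gives the global bound 1 / d. The gauge must be defined on the entire box, so a point
    off the boundary receives a ball that misses the boundary. *)
Lemma continuous_on_bounded (Omega : R3 -> Prop) (f : R3 -> C) :
  bounded_set Omega -> continuous_on (boundary Omega) f ->
  exists M, 0 < M /\ forall y, boundary Omega y -> Cmod (f y) <= M.
Proof.
  intros HO Hf; destruct (boundary_coord_bounded Omega HO) as [r Hr].
  assert (Hloc : forall y : R3, exists d : posreal,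
    forall z, ball y d z -> boundary Omega z -> Cmod (f z) <= / d).
  { intros y; destruct (classic (boundary Omega y)) as [Hy|Hy].
    - destruct (proj1 (continuous_on_C_iff _ f) Hf y Hy 1 Rlt_0_1) as [d Hd].
      assert (P := Cmod_ge_0 (f y)).
      assert (HI : 0 < / (Cmod (f y) + 1)) by (apply Rinv_0_lt_compat; lra).
      assert (Hm : 0 < Rmin d (/ (Cmod (f y) + 1))) by (apply Rmin_glb_lt; [apply cond_pos | exact HI]).
      exists (mkposreal _ Hm); intros z Hz Bz; cbn [pos].
      apply Rle_trans with (Cmod (f y) + 1).
      + assert (T := Cmod_le_plus (f z) (f y)).
        assert (Cmod (f z - f y) < 1); [|lra].
        apply Hd; [|exact Bz]; apply ball_le with (2 := Hz), Rmin_l.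
      + rewrite <- (Rinv_inv (Cmod (f y) + 1)) at 1; apply Rinv_le_contravar; [exact Hm | apply Rmin_r].
    - destruct (boundary_locally_complement Omega y Hy) as [d Hd]; exists d; intros z Hz Bz.
      destruct (Hd z Hz Bz). }
  set (delta := fun y => proj1_sig (constructive_indefinite_description _ (Hloc y))).
  assert (Hdelta : forall y z, ball y (delta y) z -> boundary Omega z -> Cmod (f z) <= / delta y)
    by (intros y; exact (proj2_sig (constructive_indefinite_description _ (Hloc y)))).
  destruct (compactness_value 3 (- r, (- r, (- r, tt))) (r, (r, (r, tt)))
    (fun t => delta (fst t, fst (snd t), fst (snd (snd t))))) as [d Hd].
  exists (/ d); split; [apply Rinv_0_lt_compat, cond_pos|].
  intros [[a b] c] Hy; apply NNPP; intros N.
  apply (Hd (a, (b, (c, tt)))).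
  - destruct (Hr a b c Hy) as [Ha [Hb Hc]]; cbn; auto.
  - intros [[a' [b' [c' []]]] [_ [[Ka [Kb [Kc _]]] Hle]]]; cbn [fst snd] in *; apply N.
    apply Rle_trans with (/ delta (a', b', c')).
    + apply Hdelta; [|exact Hy]; split; [split|]; assumption.
    + apply Rinv_le_contravar; [apply cond_pos | exact Hle].
Qed.

Lemma continuous_on_affine (D : R3 -> Prop) (a : C) (f g : R3 -> C) :
  continuous_on D f -> continuous_on D g -> continuous_on D (fun y => a * f y + g y)%C.
Proof.
  rewrite !continuous_on_C_iff; intros Hf Hg x Dx eps He.
  assert (P := Cmod_ge_0 a).
  assert (He' : 0 < eps / (2 * (Cmod a + 1))) by (apply Rdiv_lt_0_compat; lra).
  generalize (filter_and _ _ (Hf x Dx _ He') (Hg x Dx (eps / 2) ltac:(lra))).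
  apply filter_imp; intros y [K1 K2] Dy; specialize (K1 Dy); specialize (K2 Dy).
  replace (a * f y + g y - (a * f x + g x))%C with (a * (f y - f x) + (g y - g x))%C by ring.
  eapply Rle_lt_trans; [apply Cmod_triangle|]; rewrite Cmod_mult.
  assert (Cmod a * Cmod (f y - f x) <= (Cmod a + 1) * (eps / (2 * (Cmod a + 1)))).
  { apply Rmult_le_compat; try apply Cmod_ge_0; lra. }
  replace ((Cmod a + 1) * (eps / (2 * (Cmod a + 1)))) with (eps / 2) in * by (field; lra).
  lra.
Qed.

Lemma continuous_on_Csum (D : R3 -> Prop) (a : nat -> R3 -> C) (c : nat -> C) (J : nat) :
  (forall j, continuous_on D (a j)) -> continuous_on D (fun y => Csum (fun j => a j y * c j)%C 0 J).
Proof.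
  intros Ha; induction J as [|J IH].
  - apply continuous_on_ext with (fun y => c 0%nat * a 0%nat y + 0)%C.
    + intros y _; rewrite Csum_n_n, Cplus_0_r; apply Cmult_comm.
    + apply continuous_on_affine; [apply Ha|].
      intros x _; apply filterlim_const.
  - apply continuous_on_ext with (fun y => c (S J) * a (S J) y + Csum (fun j => a j y * c j) 0 J)%C.
    + intros y _; rewrite Csum_S, (Cmult_comm (c (S J))) by lia; apply Cplus_comm.
    + apply continuous_on_affine; [apply Ha | exact IH].
Qed.

Lemma continuous_on_uniform_limit (D : R3 -> Prop) (f : R3 -> C) :
  (forall eps, 0 < eps -> exists h, continuous_on D h /\ forall y, D y -> Cmod (f y - h y) <= eps) ->
  continuous_on D f.
Proof.
  intros H; apply continuous_on_C_iff; intros x Dx eps He.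
  destruct (H (eps / 3) ltac:(lra)) as [h [Hh Kh]].
  generalize (proj1 (continuous_on_C_iff D h) Hh x Dx (eps / 3) ltac:(lra)).
  apply filter_imp; intros y Hy Dy; specialize (Hy Dy).
  assert (K1 := Kh x Dx); assert (K2 := Kh y Dy).
  replace (f y - f x)%C with ((f y - h y) + ((h y - h x) + (h x - f x)))%C by ring.
  eapply Rle_lt_trans; [apply Cmod_triangle|].
  apply Rle_lt_trans with (eps / 3 + (Cmod (h y - h x) + Cmod (h x - f x))).
  - apply Rplus_le_compat; [exact K2 | apply Cmod_triangle].
  - rewrite (Cmod_minus_sym (h x)); lra.
Qed.

(* Cauchy estimates uniform in q; applied with q a boundary point, and with q = (f, b) where
   |f| <= b on the boundary. *)
Lemma coefficient_bound (Q : Type) (D : Q -> Prop) (beta : Q -> R) (c : nat -> Q -> C)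
    (s : Q -> C) (rho : R) (J0 : nat) :
  0 < rho -> (forall q, D q -> 0 <= beta q) ->
  (forall j, exists M, forall q, D q -> Cmod (c j q) <= M * beta q) ->
  (forall J, (J0 <= J)%nat -> forall q, D q ->
     Cmod (s q - Csum (fun j => c j q * rho ^ j)%C 0 J) <= beta q) ->
  exists K, 0 < K /\ forall j q, D q -> Cmod (c j q) <= K / rho ^ j * beta q.
Proof.
  intros Hrho Hb HM Hs.
  assert (Hp : forall j, 0 < rho ^ j) by (intros j; apply pow_lt, Hrho).
  assert (Hfin : forall J, exists K, 0 < K /\ forall j q, (j <= J)%nat -> D q ->
            Cmod (c j q) <= K / rho ^ j * beta q).
  { assert (H1 : forall j, exists K, 0 < K /\ forall q, D q -> Cmod (c j q) <= K / rho ^ j * beta q).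
    { intros j; destruct (HM j) as [M HMj]; specialize (Hp j).
      exists ((Rabs M + 1) * rho ^ j); split.
      - apply Rmult_lt_0_compat; [assert (T := Rabs_pos M); lra | exact Hp].
      - intros q Dq; eapply Rle_trans; [apply HMj, Dq|].
        replace ((Rabs M + 1) * rho ^ j / rho ^ j) with (Rabs M + 1) by (field; lra).
        apply Rmult_le_compat_r; [apply Hb, Dq|]; assert (T := Rle_abs M); lra. }
    induction J as [|J [K [HK IH]]].
    - destruct (H1 0%nat) as [K [HK K0]]; exists K; split; [exact HK|].
      intros j q Hj Dq; replace j with 0%nat by lia; apply K0, Dq.
    - destruct (H1 (S J)) as [K' [HK' K0]]; exists (Rmax K K'); split.
      { eapply Rlt_le_trans; [exact HK | apply Rmax_l]. }
      intros j q Hj Dq; destruct (Nat.eq_dec j (S J)) as [->|E].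
      + eapply Rle_trans; [apply K0, Dq|]; apply Rmult_le_compat_r; [apply Hb, Dq|].
        apply Rmult_le_compat_r; [left; apply Rinv_0_lt_compat, Hp | apply Rmax_r].
      + eapply Rle_trans; [apply IH; [lia | exact Dq]|]; apply Rmult_le_compat_r; [apply Hb, Dq|].
        apply Rmult_le_compat_r; [left; apply Rinv_0_lt_compat, Hp | apply Rmax_l]. }
  destruct (Hfin J0) as [K [HK HK']].
  (* Beyond [J0] a term is the difference of two consecutive partial sums, each within beta of the
     limit, hence at most 2 beta. The finitely many earlier coefficients are bounded one by one by
     K. *)
  exists (Rmax K 2); split; [eapply Rlt_le_trans; [exact HK | apply Rmax_l]|].
  intros j q Dq; specialize (Hp j); specialize (Hb q Dq).
  destruct (Nat.le_gt_cases j J0) as [L|L].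
  - eapply Rle_trans; [apply HK'; [exact L | exact Dq]|]; apply Rmult_le_compat_r; [exact Hb|].
    apply Rmult_le_compat_r; [left; apply Rinv_0_lt_compat, Hp | apply Rmax_l].
  - destruct j as [|j]; [lia|].
    assert (E1 := Hs j ltac:(lia) q Dq); assert (E2 := Hs (S j) ltac:(lia) q Dq).
    rewrite Csum_S in E2 by lia; set (S0 := Csum _ 0 j) in *.
    assert (E : Cmod (c (S j) q * rho ^ S j) <= 2 * beta q).
    { replace (c (S j) q * rho ^ S j)%C with
        ((s q - S0) - (s q - (S0 + c (S j) q * rho ^ S j)))%C by ring.
      eapply Rle_trans; [apply Cmod_triangle|]; rewrite Cmod_opp; lra. }
    rewrite Cmod_mult, Cmod_pow, Cmod_R, (Rabs_pos_eq rho) in E by lra.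
    apply Rmult_le_reg_r with (rho ^ S j); [exact Hp|].
    eapply Rle_trans; [exact E|].
    replace (Rmax K 2 / rho ^ S j * beta q * rho ^ S j) with (Rmax K 2 * beta q) by (field; lra).
    apply Rmult_le_compat_r; [exact Hb | apply Rmax_r].
Qed.

(** * Two-point estimates for power series *)

Lemma Cpow_minus_bound (w w' : C) (d : R) (j : nat) :
  Cmod w <= d -> Cmod w' <= d -> Cmod (w ^ S j - w' ^ S j) <= INR (S j) * d ^ j * Cmod (w - w').
Proof.
  intros Hw Hw'; assert (Hd : 0 <= d) by (assert (T := Cmod_ge_0 w); lra).
  induction j as [|j IH].
  - rewrite !Cpow_1_r; cbn; lra.
  - rewrite (Cpow_S w (S j)), (Cpow_S w' (S j)).
    replace (w * w ^ S j - w' * w' ^ S j)%C with (w * (w ^ S j - w' ^ S j) + (w - w') * w' ^ S j)%C by ring.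
    eapply Rle_trans; [apply Cmod_triangle|]; rewrite !Cmod_mult, Cmod_pow.
    apply Rle_trans with (d * (INR (S j) * d ^ j * Cmod (w - w')) + Cmod (w - w') * d ^ S j).
    + apply Rplus_le_compat.
      * apply Rmult_le_compat; try apply Cmod_ge_0; assumption.
      * apply Rmult_le_compat_l; [apply Cmod_ge_0|]; apply pow_incr; split; [apply Cmod_ge_0 | exact Hw'].
    + right; rewrite (S_INR (S j)); cbn [pow]; ring.
Qed.

Definition converges_to (u : nat -> C) (s : C) : Prop :=
  forall eps, 0 < eps -> exists J0, forall J, (J0 <= J)%nat -> Cmod (s - u J) <= eps.

(** Passes from coefficient bounds to strict differentiability at the centre. The constant and
    linear terms are accounted for exactly, and each later term contains at least one factor d
    besides |w - w'|, so the remainder is small relative to |w - w'| as d shrinks. *)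
Lemma power_series_strict (c : nat -> C) (K rho d : R) (w w' s s' : C) :
  0 < rho -> (forall j, Cmod (c j) <= K / rho ^ j) -> d <= rho / 4 ->
  Cmod w <= d -> Cmod w' <= d ->
  converges_to (Csum (fun j => c j * w ^ j)%C 0) s ->
  converges_to (Csum (fun j => c j * w' ^ j)%C 0) s' ->
  Cmod (s - s' - (w - w') * c 1%nat) <= 8 * (K / rho ^ 2) * d * Cmod (w - w').
Proof.
  intros Hrho Hc Hd Hw Hw' Hs Hs'.
  assert (Hd0 : 0 <= d) by (assert (T := Cmod_ge_0 w); lra).
  assert (HK : 0 <= K).
  { assert (T := Hc 0%nat); assert (T' := Cmod_ge_0 (c 0%nat)); cbn in T; lra. }
  set (h := Cmod (w - w')); assert (Hh : 0 <= h) by apply Cmod_ge_0.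
  set (L := K / rho ^ 2 * d * h).
  assert (Hr2 : 0 < rho ^ 2) by (apply pow_lt, Hrho).
  assert (HL : 0 <= L).
  { unfold L; repeat apply Rmult_le_pos; trivial; left; apply Rinv_0_lt_compat, Hr2. }
  (* The term of index m + 2 is at most L (m + 2) (d / rho)^m. With m + 2 <= 4 * 2^m and d / rho <=
     1/4 this is at most 4 L 2^{-m}, and these bounds sum to 8 L. *)
  assert (P : forall m, Cmod (Csum (fun j => c j * w ^ j) 0 (S m) - Csum (fun j => c j * w' ^ j) 0 (S m)
            - (w - w') * c 1%nat)%C <= L * (8 - 8 * (/ 2) ^ m)).
  { induction m as [|m IH].
    - rewrite !Csum_S, !Csum_n_n by lia.
      match goal with |- Cmod ?e <= _ => replace e with (RtoC 0) by (cbn; ring) end.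
      rewrite Cmod_0; cbn; lra.
    - rewrite (Csum_S _ 0 (S m)), (Csum_S (fun j => c j * w' ^ j)%C 0 (S m)) by lia.
      set (a := Csum (fun j => c j * w ^ j)%C 0 (S m)) in *.
      set (b := Csum (fun j => c j * w' ^ j)%C 0 (S m)) in *.
      replace (a + c (S (S m)) * w ^ S (S m) - (b + c (S (S m)) * w' ^ S (S m)) - (w - w') * c 1%nat)%C
        with ((a - b - (w - w') * c 1%nat) + c (S (S m)) * (w ^ S (S m) - w' ^ S (S m)))%C by ring.
      eapply Rle_trans; [apply Cmod_triangle|].
      replace (L * (8 - 8 * (/ 2) ^ S m)) with (L * (8 - 8 * (/ 2) ^ m) + L * (4 * (/ 2) ^ m))
        by (cbn [pow]; field).
      apply Rplus_le_compat; [exact IH|]; rewrite Cmod_mult.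
      apply Rle_trans with (K / rho ^ S (S m) * (INR (S (S m)) * d ^ S m * h)).
      { apply Rmult_le_compat; try apply Cmod_ge_0; [apply Hc | apply Cpow_minus_bound; assumption]. }
      assert (Hrm : 0 < rho ^ m) by (apply pow_lt, Hrho).
      replace (K / rho ^ S (S m) * (INR (S (S m)) * d ^ S m * h)) with
        (L * (INR (S (S m)) * (d / rho) ^ m)).
      2:{ unfold L, Rdiv; rewrite Rpow_mult_distr, pow_inv; cbn [pow]; field; lra. }
      apply Rmult_le_compat_l; [exact HL|].
      assert (B1 : INR (S (S m)) <= 4 * 2 ^ m).
      { clear; induction m as [|m IH]; [cbn; lra|]; rewrite S_INR; cbn [pow].
        assert (1 <= 2 ^ m) by (apply pow_R1_Rle; lra); lra. }
      assert (B2 : (d / rho) ^ m <= (/ 4) ^ m).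
      { apply pow_incr; split.
        - apply Rmult_le_pos; [exact Hd0 | left; apply Rinv_0_lt_compat, Hrho].
        - apply Rmult_le_reg_r with rho; [exact Hrho|]; unfold Rdiv; rewrite Rmult_assoc, Rinv_l; lra. }
      apply Rle_trans with (4 * 2 ^ m * (/ 4) ^ m).
      + apply Rmult_le_compat; [apply pos_INR | | exact B1 | exact B2].
        apply pow_le, Rmult_le_pos; [exact Hd0 | left; apply Rinv_0_lt_compat, Hrho].
      + right; rewrite Rmult_assoc, <- Rpow_mult_distr; do 2 f_equal; field. }
  replace (8 * (K / rho ^ 2) * d * h) with (8 * L) by (unfold L; ring).
  apply Rle_plus_epsilon; intros eps He.
  destruct (Hs (eps / 2) ltac:(lra)) as [J1 H1], (Hs' (eps / 2) ltac:(lra)) as [J2 H2].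
  specialize (H1 (S (J1 + J2)) ltac:(lia)); specialize (H2 (S (J1 + J2)) ltac:(lia)).
  specialize (P (J1 + J2)%nat).
  set (a := Csum (fun j => c j * w ^ j)%C 0 _) in *; set (b := Csum (fun j => c j * w' ^ j)%C 0 _) in *.
  replace (s - s' - (w - w') * c 1%nat)%C with
    ((a - b - (w - w') * c 1%nat) + ((s - a) + - (s' - b)))%C by ring.
  eapply Rle_trans; [apply Cmod_triangle|]; apply Rplus_le_compat.
  - eapply Rle_trans; [exact P|].
    assert (0 <= (/ 2) ^ (J1 + J2)) by (apply pow_le; lra).
    assert (0 <= L * (8 * (/ 2) ^ (J1 + J2))) by (apply Rmult_le_pos; lra); lra.
  - eapply Rle_trans; [apply Cmod_triangle|]; rewrite Cmod_opp; lra.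
Qed.

Lemma converges_to_unique (u : nat -> C) (s t : C) :
  converges_to u s -> converges_to u t -> s = t.
Proof.
  intros Hs Ht; apply Ceq_minus, Cmod_eq_0, Rle_antisym; [|apply Cmod_ge_0].
  apply Rle_plus_epsilon; intros eps He; rewrite Rplus_0_l.
  destruct (Hs (eps / 2) ltac:(lra)) as [J1 H1], (Ht (eps / 2) ltac:(lra)) as [J2 H2].
  specialize (H1 (J1 + J2)%nat ltac:(lia)); specialize (H2 (J1 + J2)%nat ltac:(lia)).
  replace (s - t)%C with ((s - u (J1 + J2)%nat) - (t - u (J1 + J2)%nat))%C by ring.
  eapply Rle_trans; [apply Cmod_triangle|]; rewrite Cmod_opp; lra.
Qed.

Lemma converges_to_affine (a : C) (u v w : nat -> C) (s t : C) :
  (forall J, w J = a * u J + v J)%C ->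
  converges_to u s -> converges_to v t -> converges_to w (a * s + t)%C.
Proof.
  intros Hw Hs Ht eps He; assert (P := Cmod_ge_0 a).
  assert (He' : 0 < eps / (2 * (Cmod a + 1))) by (apply Rdiv_lt_0_compat; lra).
  destruct (Hs _ He') as [J1 H1], (Ht (eps / 2) ltac:(lra)) as [J2 H2].
  exists (J1 + J2)%nat; intros J HJ; specialize (H1 J ltac:(lia)); specialize (H2 J ltac:(lia)).
  rewrite Hw; replace (a * s + t - (a * u J + v J))%C with (a * (s - u J) + (t - v J))%C by ring.
  eapply Rle_trans; [apply Cmod_triangle|]; rewrite Cmod_mult.
  assert (Cmod a * Cmod (s - u J) <= (Cmod a + 1) * (eps / (2 * (Cmod a + 1)))).
  { apply Rmult_le_compat; try apply Cmod_ge_0; lra. }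
  replace ((Cmod a + 1) * (eps / (2 * (Cmod a + 1)))) with (eps / 2) in * by (field; lra).
  lra.
Qed.

(** * Local expansions of the operator and of the data *)

(** The sign of b is recorded separately so that no boundary point has to be exhibited to obtain
    it. *)
Definition dominated (Omega : R3 -> Prop) (f : R3 -> C) (b : R) : Prop :=
  continuous_on (boundary Omega) f /\ 0 <= b /\ forall y, boundary Omega y -> Cmod (f y) <= b.

Lemma dominated_affine (Omega : R3 -> Prop) (a : C) (f g : R3 -> C) (b b' : R) :
  dominated Omega f b -> dominated Omega g b' ->
  dominated Omega (fun y => a * f y + g y)%C (Cmod a * b + b').
Proof.
  intros [Cf [Pb Hf]] [Cg [Pb' Hg]]; split; [|split].
  - apply continuous_on_affine; assumption.
  - apply Rplus_le_le_0_compat; [apply Rmult_le_pos; [apply Cmod_ge_0 | exact Pb] | exact Pb'].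
  - intros y Hy; eapply Rle_trans; [apply Cmod_triangle|]; rewrite Cmod_mult.
    apply Rplus_le_compat; [apply Rmult_le_compat_l; [apply Cmod_ge_0 | apply Hf, Hy] | apply Hg, Hy].
Qed.

Definition linear_on_boundary (Omega : R3 -> Prop) (T : (R3 -> C) -> C) : Prop :=
  forall (a : C) (f g : R3 -> C),
    continuous_on (boundary Omega) f -> continuous_on (boundary Omega) g ->
    T (fun y => a * f y + g y)%C = (a * T f + T g)%C.

(** Specializes uniform convergence on compact sets to evaluation at the fixed point x, turning
    operators into functionals. *)
Lemma compact_singleton (A : R3 -> Prop) (x : R3) : A x -> compact_subset (fun y => y = x) A.
Proof.
  intros Ax; split; [|split].
  - intros y Hy.
    assert (H : forall eps : posreal, ball y eps x).
    { intros eps; apply NNPP; intros N; apply Hy; exists eps; intros z Hz ->; exact (N Hz). }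
    destruct x as [[x1 x2] x3], y as [[y1 y2] y3].
    repeat apply injective_projections; apply cond_eq; intros eps He;
      destruct (H (mkposreal eps He)) as [[H1 H2] H3]; rewrite <- Rabs_Ropp, Ropp_minus_distr;
      [exact H1 | exact H2 | exact H3].
  - exists (norm3 x); intros y ->; apply Rle_refl.
  - intros y ->; exact Ax.
Qed.

(** The first-order expansion of k -> B(k) f at x, with constants that depend on f only through its
    bound b; this permits the datum to vary with z. Linearity of B(k) near p is inherited from the
    partial sums of the series by passage to the limit. *)
Lemma operator_local_expansion (Omega : R3 -> Prop) (B : C -> (R3 -> C) -> R3 -> C) (p : C) (x : R3) :
  bounded_set Omega -> exterior Omega x -> operator_analytic_at Omega B p ->
  exists (A1 : (R3 -> C) -> C) (K d0 : R), 0 < K /\ 0 < d0 /\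
    linear_on_boundary Omega A1 /\
    (forall k, Cmod (k - p) <= d0 -> linear_on_boundary Omega (fun f => B k f x)) /\
    (forall f b, dominated Omega f b -> Cmod (A1 f) <= K * b /\ Cmod (B p f x) <= K * b) /\
    (forall f b k k' d, dominated Omega f b -> d <= d0 -> Cmod (k - p) <= d -> Cmod (k' - p) <= d ->
       Cmod (B k f x - B k' f x - (k - k') * A1 f) <= K * d * Cmod (k - k') * b).
Proof.
  intros HO Hx [A [r [Hr [HA Hser]]]].
  set (K0 := fun y : R3 => y = x).
  assert (HK0 : compact_subset K0 (exterior Omega)) by (apply compact_singleton, Hx).
  assert (Hunif : forall k, Cmod (k - p) < r -> forall eps, 0 < eps -> exists J0, forall J, (J0 <= J)%nat ->
    forall f b, dominated Omega f b ->
      Cmod (B k f x - Csum (fun j => A j f x * (k - p) ^ j)%C 0 J) <= eps * b).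
  { intros k Hk eps He; destruct (Hser k Hk (or_intror eq_refl) K0 HK0 eps He) as [J0 HJ].
    exists J0; intros J HJ0 f b [Cf [Pb Hf]]; specialize (HJ J HJ0 f b Cf Hf x eq_refl).
    rewrite (Csum_ext_loc _ (fun j => (k - p) ^ j / (k - p) ^ 0 * A j f x)%C); [exact HJ|].
    intros j _; cbn; field. }
  assert (Hlim : forall k f b, Cmod (k - p) < r -> dominated Omega f b ->
    converges_to (Csum (fun j => A j f x * (k - p) ^ j)%C 0) (B k f x)).
  { intros k f b Hk Hf eps He; assert (Pb := proj1 (proj2 Hf)).
    destruct (Hunif k Hk (eps / (b + 1)) ltac:(apply Rdiv_lt_0_compat; lra)) as [J0 HJ].
    exists J0; intros J HJ0; eapply Rle_trans; [apply HJ; [exact HJ0 | exact Hf]|].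
    apply Rmult_le_reg_r with (b + 1); [lra|].
    replace (eps / (b + 1) * b * (b + 1)) with (eps * b) by (field; lra); lra. }
  set (rho := r / 2); assert (Hrho : 0 < rho) by (unfold rho; lra).
  (* Convergence at this one point, at distance rho = r/2 from p and uniform over dominated data, is
     the source of the coefficient bounds. *)
  destruct (Hunif (p + rho)%C) with (eps := 1) as [J0 HJ0].
  { replace (p + rho - p)%C with (RtoC rho) by ring; rewrite Cmod_R, Rabs_pos_eq; unfold rho; lra. }
  { lra. }
  destruct (coefficient_bound ((R3 -> C) * R) (fun q => dominated Omega (fst q) (snd q)) snd
    (fun j q => A j (fst q) x) (fun q => B (p + rho)%C (fst q) x) rho J0) as [K [HK Hcoef]].
  { exact Hrho. }
  { intros q Hq; apply Hq. }
  { intros j; destruct (HA j) as [_ [_ Hb]]; destruct (Hb K0 HK0) as [M HM].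
    exists M; intros [f b] [Cf [_ Hf]]; exact (HM f b Cf Hf x eq_refl). }
  { intros J HJ [f b] Hf; cbn [fst snd] in *.
    specialize (HJ0 J HJ f b Hf); rewrite Rmult_1_l in HJ0.
    replace (p + rho - p)%C with (RtoC rho) in HJ0 by ring; exact HJ0. }
  assert (Hc : forall f b, dominated Omega f b -> forall j, Cmod (A j f x) <= K * b / rho ^ j).
  { intros f b Hf j; eapply Rle_trans; [apply (Hcoef j (f, b) Hf)|]; right; cbn [snd].
    unfold Rdiv; ring. }
  assert (Hk : forall k, Cmod (k - p) <= rho / 4 -> Cmod (k - p) < r) by (intros k H; unfold rho in H; lra).
  assert (P1 : 0 < K / rho) by (apply Rdiv_lt_0_compat; lra).
  assert (P2 : 0 < K / rho ^ 2) by (apply Rdiv_lt_0_compat; [lra | apply pow_lt, Hrho]).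
  assert (Hlin : forall j, linear_on_boundary Omega (fun f => A j f x)).
  { intros j a f g Cf Cg; destruct (HA j) as [_ [Hl _]]; apply Hl; assumption. }
  (* One constant majorizes three bounds: 8 K / rho^2 for the two-point remainder, K / rho for A_1,
     and K for A_0, which coincides with B(p). *)
  exists (fun f => A 1%nat f x), (8 * (K / rho ^ 2) + K / rho + K), (rho / 4).
  split; [lra|]; split; [lra|]; split; [apply Hlin|]; split; [|split].
  - intros k Hkd a f g Cf Cg.
    destruct (continuous_on_bounded Omega f HO Cf) as [M [HM Mf]].
    destruct (continuous_on_bounded Omega g HO Cg) as [M' [HM' Mg]].
    assert (Df : dominated Omega f M) by (split; [exact Cf | split; [lra | exact Mf]]).
    assert (Dg : dominated Omega g M') by (split; [exact Cg | split; [lra | exact Mg]]).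
    assert (Ck := Hk k Hkd).
    apply (converges_to_unique _ _ _ (Hlim k _ _ Ck (dominated_affine Omega a f g M M' Df Dg))).
    apply (converges_to_affine a _ _ _ _ _) with (2 := Hlim k f M Ck Df) (3 := Hlim k g M' Ck Dg).
    intros J; rewrite <- Csum_mult_l, <- Csum_plus; apply Csum_ext_loc; intros j _.
    rewrite (Hlin j a f g Cf Cg); ring.
  - intros f b Hf; assert (Pb := proj1 (proj2 Hf)); split.
    + eapply Rle_trans; [apply (Hc f b Hf)|].
      replace (K * b / rho ^ 1) with (K / rho * b) by (cbn [pow]; field; lra).
      apply Rmult_le_compat_r; lra.
    + replace (B p f x) with (A 0%nat f x).
      * eapply Rle_trans; [apply (Hc f b Hf)|].
        replace (K * b / rho ^ 0) with (K * b) by (cbn [pow]; field).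
        apply Rmult_le_compat_r; lra.
      * refine (converges_to_unique _ _ _ _ (Hlim p f b _ Hf)).
        2:{ rewrite Cmod_minus_self; exact Hr. }
        intros eps He; exists 0%nat; intros J _.
        rewrite (Csum_single _ 0 J); [| lia |].
        -- replace (A 0%nat f x - A 0%nat f x * (p - p) ^ 0)%C with (RtoC 0) by (cbn; ring).
           rewrite Cmod_0; lra.
        -- intros [|j] _ Hj; [congruence|]; cbn; ring.
  - intros f b k k' d Hf Hd Hkd Hkd'; assert (Pb := proj1 (proj2 Hf)).
    assert (H := power_series_strict (fun j => A j f x) (K * b) rho d (k - p) (k' - p)
      (B k f x) (B k' f x) Hrho (Hc f b Hf) Hd Hkd Hkd'
      (Hlim k f b (Hk k (Rle_trans _ _ _ Hkd Hd)) Hf)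
      (Hlim k' f b (Hk k' (Rle_trans _ _ _ Hkd' Hd)) Hf)).
    cbv beta in H; replace (k - p - (k' - p))%C with (k - k')%C in H by ring.
    eapply Rle_trans; [exact H|].
    replace (8 * (K * b / rho ^ 2) * d * Cmod (k - k')) with
      (8 * (K / rho ^ 2) * (d * Cmod (k - k') * b)) by (unfold Rdiv; ring).
    rewrite !Rmult_assoc; rewrite <- (Rmult_assoc 8); apply Rmult_le_compat_r; [|lra].
    apply Rmult_le_pos; [|apply Rmult_le_pos; [apply Cmod_ge_0 | exact Pb]].
    assert (T := Cmod_ge_0 (k - p)); lra.
Qed.

(** The counterpart for the data, uniform in the boundary point y. Continuity of F(z) on the
    boundary comes from the expansion itself: its partial sums have continuous coefficients and
    converge uniformly there. *)
Lemma data_local_expansion (Omega : R3 -> Prop) (F : C -> R3 -> C) (z0 : C) :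
  bounded_set Omega -> boundary_analytic_at Omega F z0 ->
  exists (a1 : R3 -> C) (K d0 : R), 0 < K /\ 0 < d0 /\
    dominated Omega a1 K /\ dominated Omega (F z0) K /\
    (forall z, Cmod (z - z0) <= d0 -> continuous_on (boundary Omega) (F z)) /\
    (forall y z z' d, boundary Omega y -> d <= d0 -> Cmod (z - z0) <= d -> Cmod (z' - z0) <= d ->
       Cmod (F z y - F z' y - (z - z') * a1 y) <= K * d * Cmod (z - z')).
Proof.
  intros HO [a [r [Hr [Ca Hser]]]].
  set (rho := r / 2); assert (Hrho : 0 < rho) by (unfold rho; lra).
  assert (HF : forall z, Cmod (z - z0) < r -> continuous_on (boundary Omega) (F z)).
  { intros z Hz; apply continuous_on_uniform_limit; intros eps He.
    destruct (Hser z Hz eps He) as [J0 HJ].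
    exists (fun y => Csum (fun j => a j y * (z - z0) ^ j)%C 0 J0); split.
    - apply continuous_on_Csum, Ca.
    - apply HJ; lia. }
  destruct (Hser (z0 + rho)%C) with (eps := 1) as [J0 HJ0].
  { replace (z0 + rho - z0)%C with (RtoC rho) by ring; rewrite Cmod_R, Rabs_pos_eq; unfold rho; lra. }
  { lra. }
  destruct (coefficient_bound R3 (boundary Omega) (fun _ => 1) a (F (z0 + rho)%C) rho J0)
    as [K [HK Hc]].
  { exact Hrho. }
  { intros; lra. }
  { intros j; destruct (continuous_on_bounded Omega (a j) HO (Ca j)) as [M [_ HM]].
    exists M; intros y Hy; rewrite Rmult_1_r; apply HM, Hy. }
  { intros J HJ y Hy; specialize (HJ0 J HJ y Hy).
    replace (z0 + rho - z0)%C with (RtoC rho) in HJ0 by ring; exact HJ0. }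
  assert (Hc' : forall j y, boundary Omega y -> Cmod (a j y) <= K / rho ^ j).
  { intros j y Hy; rewrite <- (Rmult_1_r (K / rho ^ j)); apply Hc, Hy. }
  assert (P1 : 0 < K / rho) by (apply Rdiv_lt_0_compat; lra).
  assert (P2 : 0 < K / rho ^ 2) by (apply Rdiv_lt_0_compat; [lra | apply pow_lt, Hrho]).
  assert (Hlim : forall y z, boundary Omega y -> Cmod (z - z0) < r ->
    converges_to (Csum (fun j => a j y * (z - z0) ^ j)%C 0) (F z y)).
  { intros y z Hy Hz eps He; destruct (Hser z Hz eps He) as [J HJ]; exists J; intros J' HJ'.
    apply HJ; assumption. }
  exists (a 1%nat), (8 * (K / rho ^ 2) + K / rho + K), (rho / 4).
  split; [lra|]; split; [lra|]; split; [|split; [|split]].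
  - split; [apply Ca|]; split; [lra|]; intros y Hy; eapply Rle_trans; [apply Hc', Hy|].
    rewrite pow_1; lra.
  - split; [apply HF; rewrite Cmod_minus_self; exact Hr|]; split; [lra|]; intros y Hy.
    replace (F z0 y) with (a 0%nat y).
    + eapply Rle_trans; [apply Hc', Hy|].
      replace (K / rho ^ 0) with K by (cbn [pow]; field); lra.
    + refine (converges_to_unique _ _ _ _ (Hlim y z0 Hy _)).
      2:{ rewrite Cmod_minus_self; exact Hr. }
      intros eps He; exists 0%nat; intros J _.
      rewrite (Csum_single _ 0 J); [| lia |].
      -- replace (a 0%nat y - a 0%nat y * (z0 - z0) ^ 0)%C with (RtoC 0) by (cbn; ring).
         rewrite Cmod_0; lra.
      -- intros [|j] _ Hj; [congruence|]; cbn; ring.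
  - intros z Hz; apply HF; unfold rho in Hz; lra.
  - intros y z z' d Hy Hd Hz Hz'.
    assert (H := power_series_strict (fun j => a j y) K rho d (z - z0) (z' - z0)
      (F z y) (F z' y) Hrho (fun j => Hc' j y Hy) Hd Hz Hz'
      (Hlim y z Hy ltac:(unfold rho in Hd; lra)) (Hlim y z' Hy ltac:(unfold rho in Hd; lra))).
    cbv beta in H; replace (z - z0 - (z' - z0))%C with (z - z')%C in H by ring.
    eapply Rle_trans; [exact H|]; apply Rmult_le_compat_r; [apply Cmod_ge_0|].
    apply Rmult_le_compat_r; [assert (T := Cmod_ge_0 (z - z0)); lra | lra].
Qed.

(** * Analyticity of the transformed solution *)

(** A product rule for the bilinear pairing of operator and datum, combined with the chain rule for
    z -> k(z): the derivative is kappa A_1(F(z0)) + B(p) a_1. *)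
Lemma strict_derive_operator_applied (Omega : R3 -> Prop) (B : C -> (R3 -> C) -> R3 -> C)
    (F : C -> R3 -> C) (k : C -> C) (z0 kappa : C) (x : R3) :
  bounded_set Omega -> exterior Omega x -> operator_analytic_at Omega B (k z0) ->
  boundary_analytic_at Omega F z0 -> strict_derive k z0 kappa ->
  exists l, strict_derive (fun z => B (k z) (F z) x) z0 l.
Proof.
  intros HO Hx HB HF Hk; set (p := k z0) in *.
  destruct (operator_local_expansion Omega B p x HO Hx HB)
    as [A1 [P [d1 [HP [Hd1 [LA [LB [BA EB]]]]]]]].
  destruct (data_local_expansion Omega F z0 HO HF)
    as [a1 [Q [d2 [HQ [Hd2 [Da1 [DF0 [CF EF]]]]]]]].
  exists (kappa * A1 (F z0) + B p a1 x)%C; intros eps He.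
  set (m := Cmod kappa); assert (Hm : 0 <= m) by apply Cmod_ge_0.
  (* The five error terms estimated at the end contribute 3 (m + 1), 3, 2 m, 3 and 2, in units of P
     Q e |z - z'|. *)
  set (S := P * Q * (5 * m + 11)).
  assert (HPQ : 0 < P * Q) by (apply Rmult_lt_0_compat; assumption).
  assert (HS : 0 < S) by (apply Rmult_lt_0_compat; lra).
  set (e := Rmin (Rmin d1 d2) (Rmin 1 (eps / S))).
  assert (e1 : e <= d1) by (eapply Rle_trans; apply Rmin_l).
  assert (e2 : e <= d2) by (eapply Rle_trans; [apply Rmin_l | apply Rmin_r]).
  assert (e3 : e <= 1) by (eapply Rle_trans; [apply Rmin_r | apply Rmin_l]).
  assert (e4 : e <= eps / S) by (eapply Rle_trans; apply Rmin_r).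
  assert (He0 : 0 < e).
  { repeat apply Rmin_glb_lt; try assumption; [lra | apply Rdiv_lt_0_compat; assumption]. }
  assert (HeS : e * S <= eps).
  { replace eps with (eps / S * S) by (field; lra); apply Rmult_le_compat_r; lra. }
  destruct (Hk e He0) as [d3 [Hd3 K3]].
  destruct (strict_derive_continuous _ _ _ Hk e He0) as [d4 [Hd4 K4]]; fold p in K4.
  destruct (strict_derive_lipschitz _ _ _ Hk) as [d5 [Hd5 K5]]; fold m in K5.
  set (d := Rmin e (Rmin d3 (Rmin d4 d5))).
  assert (D1 : d <= e) by apply Rmin_l.
  assert (D3 : d <= d3) by (eapply Rle_trans; [apply Rmin_r | apply Rmin_l]).
  assert (D4 : d <= Rmin d4 d5) by (eapply Rle_trans; apply Rmin_r).
  assert (D5 : Rmin d4 d5 <= d4) by apply Rmin_l; assert (D6 : Rmin d4 d5 <= d5) by apply Rmin_r.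
  exists d; split.
  { apply Rmin_glb_lt; [exact He0 | repeat apply Rmin_glb_lt; assumption]. }
  assert (HLp : forall q f b, Cmod (q - p) <= e -> dominated Omega f b ->
            Cmod (B q f x - B p f x) <= 2 * P * e * b).
  { intros q f b Hq Hf; assert (Pb := proj1 (proj2 Hf)).
    assert (E := EB f b q p e Hf e1 Hq ltac:(rewrite Cmod_minus_self; lra)).
    assert (E' := proj1 (BA f b Hf)).
    replace (B q f x - B p f x)%C with
      ((B q f x - B p f x - (q - p) * A1 f) + (q - p) * A1 f)%C by ring.
    eapply Rle_trans; [apply Cmod_triangle|]; rewrite Cmod_mult.
    assert (HPb : 0 <= P * b) by (apply Rmult_le_pos; lra).
    assert (Cmod (q - p) * Cmod (A1 f) <= e * (P * b))
      by (apply Rmult_le_compat; try apply Cmod_ge_0; assumption).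
    assert (P * e * Cmod (q - p) * b <= P * e * 1 * b).
    { apply Rmult_le_compat_r; [exact Pb|]; apply Rmult_le_compat_l; [|lra].
      apply Rmult_le_pos; lra. }
    lra. }
  assert (HL : forall q f b, Cmod (q - p) <= e -> dominated Omega f b -> Cmod (B q f x) <= 3 * P * b).
  { intros q f b Hq Hf; assert (Pb := proj1 (proj2 Hf)).
    assert (T := Cmod_le_plus (B q f x) (B p f x)); assert (T1 := HLp q f b Hq Hf).
    assert (T2 := proj2 (BA f b Hf)).
    assert (HPb : 0 <= P * b) by (apply Rmult_le_pos; lra).
    assert (P * b * e <= P * b * 1) by (apply Rmult_le_compat_l; lra). lra. }
  assert (HF0 : forall z y, Cmod (z - z0) <= e -> boundary Omega y -> Cmod (F z y - F z0 y) <= 2 * Q * e).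
  { intros z y Hz Hy.
    assert (E := EF y z z0 e Hy e2 Hz ltac:(rewrite Cmod_minus_self; lra)).
    assert (E' := proj2 (proj2 Da1) y Hy).
    replace (F z y - F z0 y)%C with ((F z y - F z0 y - (z - z0) * a1 y) + (z - z0) * a1 y)%C by ring.
    eapply Rle_trans; [apply Cmod_triangle|]; rewrite Cmod_mult.
    assert (Cmod (z - z0) * Cmod (a1 y) <= e * Q)
      by (apply Rmult_le_compat; try apply Cmod_ge_0; assumption).
    assert (Q * e * Cmod (z - z0) <= Q * e * 1).
    { apply Rmult_le_compat_l; [apply Rmult_le_pos; lra | lra]. }
    lra. }
  assert (DF : forall z, Cmod (z - z0) <= e -> dominated Omega (F z) (3 * Q)).
  { intros z Hz; split; [apply CF; lra|]; split; [lra|]; intros y Hy.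
    assert (T := Cmod_le_plus (F z y) (F z0 y)); assert (T1 := HF0 z y Hz Hy).
    assert (T2 := proj2 (proj2 DF0) y Hy).
    assert (Q * e <= Q * 1) by (apply Rmult_le_compat_l; lra). lra. }
  intros z z' Hz Hz'.
  assert (hz : Cmod (z - z0) <= e) by lra; assert (hz' : Cmod (z' - z0) <= e) by lra.
  assert (hk : Cmod (k z - p) <= e) by (left; apply K4; lra).
  assert (hk' : Cmod (k z' - p) <= e) by (left; apply K4; lra).
  specialize (K3 z z' ltac:(lra) ltac:(lra)); specialize (K5 z z' ltac:(lra) ltac:(lra)).
  set (h := Cmod (z - z')) in *; assert (Hh : 0 <= h) by apply Cmod_ge_0.
  assert (Cz := proj1 (DF z hz)); assert (Cz' := proj1 (DF z' hz')).
  assert (C0 := proj1 DF0); assert (Ca := proj1 Da1).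
  (* The increment of the data and its first-order remainder are written as nested combinations a f
     + g, the shape in which linearity and continuity are available. *)
  set (df := fun y => (- (1) * F z0 y + F z y)%C).
  set (rem := fun y => (- (1) * F z' y + (- (z - z') * a1 y + F z y))%C).
  assert (Ddf : dominated Omega df (2 * Q * e)).
  { split; [apply continuous_on_affine; assumption|].
    split; [repeat apply Rmult_le_pos; lra|]; intros y Hy.
    replace (df y) with (F z y - F z0 y)%C by (unfold df; ring); apply HF0; assumption. }
  assert (Drem : dominated Omega rem (Q * e * h)).
  { split; [repeat apply continuous_on_affine; assumption|].
    split; [repeat apply Rmult_le_pos; lra|]; intros y Hy.
    replace (rem y) with (F z y - F z' y - (z - z') * a1 y)%C by (unfold rem; ring).
    apply EF; assumption. }
  assert (Edf : A1 df = (A1 (F z) - A1 (F z0))%C).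
  { unfold df; rewrite (LA (- (1))%C (F z0) (F z) C0 Cz); ring. }
  assert (Erem : B (k z') rem x = (B (k z') (F z) x - B (k z') (F z') x - (z - z') * B (k z') a1 x)%C).
  { assert (L := LB (k z') ltac:(lra)); unfold rem.
    assert (E1 := L (- (1))%C (F z') (fun y => - (z - z') * a1 y + F z y)%C Cz'
      (continuous_on_affine _ (- (z - z'))%C _ _ Ca Cz)).
    assert (E2 := L (- (z - z'))%C a1 (F z) Ca Cz).
    cbv beta in E1, E2; rewrite E1, E2; ring. }
  (* The five errors are, in turn: linearizing B in k at the datum F(z); replacing k(z) - k(z') by
     kappa (z - z'); replacing F(z) by F(z0) under A_1; linearizing the datum under B(k(z')); and
     replacing B(k(z')) by B(p) on a_1. *)
  replace (B (k z) (F z) x - B (k z') (F z') x - (kappa * A1 (F z0) + B p a1 x) * (z - z'))%C with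
    ((B (k z) (F z) x - B (k z') (F z) x - (k z - k z') * A1 (F z))
     + ((k z - k z' - kappa * (z - z')) * A1 (F z)
     + (kappa * (z - z') * A1 df
     + (B (k z') rem x + (z - z') * (B (k z') a1 x - B p a1 x)))))%C
    by (rewrite Edf, Erem; ring).
  assert (T1 := EB (F z) (3 * Q) (k z) (k z') e (DF z hz) e1 hk hk').
  assert (T2 := proj1 (BA (F z) (3 * Q) (DF z hz))).
  assert (T3 := proj1 (BA df _ Ddf)).
  assert (T4 := HL (k z') rem _ hk' Drem).
  assert (T5 := HLp (k z') a1 _ hk' Da1).
  assert (B1 : Cmod (B (k z) (F z) x - B (k z') (F z) x - (k z - k z') * A1 (F z))
            <= P * Q * e * h * (3 * (m + 1))).
  { eapply Rle_trans; [exact T1|].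
    replace (P * Q * e * h * (3 * (m + 1))) with (P * e * ((m + 1) * h) * (3 * Q)) by ring.
    apply Rmult_le_compat_r; [lra|]; apply Rmult_le_compat_l; [apply Rmult_le_pos; lra | exact K5]. }
  assert (B2 : Cmod ((k z - k z' - kappa * (z - z')) * A1 (F z)) <= P * Q * e * h * 3).
  { rewrite Cmod_mult; replace (P * Q * e * h * 3) with (e * h * (P * (3 * Q))) by ring.
    apply Rmult_le_compat; try apply Cmod_ge_0; assumption. }
  assert (B3 : Cmod (kappa * (z - z') * A1 df) <= P * Q * e * h * (2 * m)).
  { rewrite !Cmod_mult; fold m h.
    replace (P * Q * e * h * (2 * m)) with (m * h * (P * (2 * Q * e))) by ring.
    apply Rmult_le_compat_l; [apply Rmult_le_pos; lra | exact T3]. }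
  assert (B4 : Cmod (B (k z') rem x) <= P * Q * e * h * 3) by lra.
  assert (B5 : Cmod ((z - z') * (B (k z') a1 x - B p a1 x)) <= P * Q * e * h * 2).
  { rewrite Cmod_mult; fold h.
    replace (P * Q * e * h * 2) with (h * (2 * P * e * Q)) by ring.
    apply Rmult_le_compat_l; [exact Hh | exact T5]. }
  apply Rle_trans with (e * S * h); [|apply Rmult_le_compat_r; assumption].
  replace (e * S * h) with (P * Q * e * h * (3 * (m + 1)) + (P * Q * e * h * 3
    + (P * Q * e * h * (2 * m) + (P * Q * e * h * 3 + P * Q * e * h * 2)))) by (unfold S; ring).
  repeat (eapply Rle_trans; [apply Cmod_triangle | apply Rplus_le_compat]); assumption.
Qed.

Lemma strict_derive_wavenumber (gam : nat -> C) (d : nat) (c dt : R) (z : C) :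
  exists l, strict_derive (wavenumber gam d c dt) z l.
Proof.
  assert (H : forall J, exists l, strict_derive (gamma gam J) z l).
  { assert (T : forall j, exists l, strict_derive (fun y => gam j * y ^ j)%C z l).
    { intros j; destruct (strict_derive_pow _ _ _ j (strict_derive_id z)) as [l Hl].
      eexists; apply (strict_derive_mult _ _ _ _ _ (strict_derive_const (gam j) z) Hl). }
    induction J as [|J [l IH]].
    - destruct (T 0%nat) as [l Hl]; exists l; apply (strict_derive_ext _ _ _ _) with (2 := Hl).
      intros y; unfold gamma; rewrite Csum_n_n; reflexivity.
    - destruct (T (S J)) as [l' Hl']; exists (l + l')%C.
      apply (strict_derive_ext _ _ _ _) with (2 := strict_derive_plus _ _ _ _ _ IH Hl').
      intros y; unfold gamma; rewrite Csum_S by lia; reflexivity. }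
  destruct (H d) as [l Hl]; eexists; unfold wavenumber.
  apply (strict_derive_mult (fun y => Ci * gamma gam d y)%C (fun _ => / RtoC (c * dt))%C).
  - apply (strict_derive_mult _ _ _ _ _ (strict_derive_const Ci z) Hl).
  - apply strict_derive_const.
Qed.

Lemma U_d_holomorphic (Omega : R3 -> Prop) (B : C -> (R3 -> C) -> R3 -> C)
    (gam : nat -> C) (d : nat) (c dt : R) (g : R -> R3 -> C) (x : R3) :
  bounded_set Omega -> operator_meromorphic Omega B -> exterior Omega x ->
  is_finite (lambda_U Omega B gam d c dt g) ->
  holomorphic_on_disc (fun z => U_d B gam d c dt g z x) (real (lambda_U Omega B gam d c dt g)).
Proof.
  intros HO HB Hx Hfin z Hz.
  assert (HzU : Rbar_lt (Cmod z) (lambda_U Omega B gam d c dt g)) by (rewrite <- Hfin; exact Hz).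
  unfold lambda_U in HzU.
  assert (HzB : Rbar_lt (Cmod z) (lambda_B Omega B gam d c dt)).
  { eapply Rbar_lt_le_trans; [exact HzU | apply Rbar_min_l]. }
  assert (HzG : Rbar_lt (Cmod z) (lambda_G Omega g dt)).
  { eapply Rbar_lt_le_trans; [exact HzU | apply Rbar_min_r]. }
  destruct (strict_derive_wavenumber gam d c dt z) as [l Hl].
  unfold U_d; apply (strict_derive_operator_applied Omega) with l; trivial.
  (* A pole at k_z would put |z| into the set whose infimum is [lambda_B]. *)
  - destruct (HB (wavenumber gam d c dt z)) as [H|H]; [exact H|exfalso].
    apply (Rbar_lt_not_le _ _ HzB), (proj1 (Glb_Rbar_correct _)).
    exists z; split; [exact H | reflexivity].
  (* If the data were not analytic at z, |z| would bound every admissible radius from above, and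
     with them the supremum [lambda_G]. *)
  - apply NNPP; intros N; apply (Rbar_lt_not_le _ _ HzG), (proj2 (Lub_Rbar_correct _)).
    intros r Hr; apply Rnot_lt_le; intros L; apply N, (Hr z L).
Qed.

Theorem theorem4p5
  (Omega : R3 -> Prop) (hOmega : bounded_domain Omega)
  (B : C -> (R3 -> C) -> R3 -> C)
  (hB : solution_operator Omega B)
  (hBmero : operator_meromorphic Omega B)
  (hBpoles : forall p, is_pole Omega B p -> Im p < 0)
  (c dt : R) (hc : 0 < c) (hdt : 0 < dt)
  (gam : nat -> C) (d : nat)
  (hgam : forall n, (d < n)%nat -> gam n = RtoC 0)
  (hgam_nonconst : exists n, (0 < n)%nat /\ gam n <> RtoC 0)
  (g : R -> R3 -> C)
  (hg : forall t, 0 <= t -> continuous_on (boundary Omega) (g t))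
  (hfin : is_finite (lambda_U Omega B gam d c dt g))
  (x : R3) (hx : exterior Omega x)
  (lambda : R) (hlambda : 0 < lambda)
  (hlambdaU : lambda < real (lambda_U Omega B gam d c dt g))
  (n : nat)
  (eps : R) (heps : 0 < eps)
  (heps' : eps < real (lambda_U Omega B gam d c dt g) / lambda) :
  exists (M : R) (N0 : nat), forall Nf : nat, (N0 <= Nf)%nat -> (1 <= Nf)%nat ->
    Cmod (u_quadrature (fun z => U_d B gam d c dt g z x) lambda Nf n
          - u_contour (fun z => U_d B gam d c dt g z x) lambda n)%C
    <= M * / (real (lambda_U Omega B gam d c dt g) / lambda - eps) ^ Nf.
Proof.
  set (rho := real (lambda_U Omega B gam d c dt g)) in *.
  (* The first entry produces the claimed rate, since (rho - eps lambda) / lambda = rho / lambda -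
     eps. It may fall below lambda when eps is large; the midpoint keeps r strictly between lambda
     and rho. *)
  set (r := Rmax (rho - eps * lambda) ((lambda + rho) / 2)).
  assert (HU := U_d_holomorphic Omega B gam d c dt g x (proj2 (proj2 (proj2 hOmega))) hBmero hx hfin).
  fold rho in HU.
  assert (He : eps * lambda < rho).
  { apply Rmult_lt_compat_r with (r := lambda) in heps'; [|exact hlambda].
    replace (rho / lambda * lambda) with rho in heps' by (field; lra); exact heps'. }
  assert (Hel : 0 < eps * lambda) by (apply Rmult_lt_0_compat; assumption).
  assert (r1 : rho - eps * lambda <= r) by apply Rmax_l.
  assert (r2 : (lambda + rho) / 2 <= r) by apply Rmax_r.
  assert (r3 : r < rho) by (apply Rmax_lub_lt; lra).
  destruct (trapezoid_error _ rho lambda r n HU hlambda ltac:(lra) r3) as [M [HM K]].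
  (* The threshold n + 1 ensures n < Nf, as the orthogonality of the nodes demands. *)
  exists M, (S n); intros Nf HN _; eapply Rle_trans; [apply K; lia|].
  apply Rmult_le_compat_l; [exact HM|]; rewrite <- pow_inv; apply pow_incr; split.
  - apply Rmult_le_pos; [lra | left; apply Rinv_0_lt_compat; lra].
  - replace (lambda / r) with (/ (r / lambda)) by (field; lra).
    apply Rinv_le_contravar; [lra|].
    replace (rho / lambda - eps) with ((rho - eps * lambda) / lambda) by (field; lra).
    apply Rmult_le_compat_r; [left; apply Rinv_0_lt_compat, hlambda | exact r1].
Qed.
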